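(* Let $F|k$ be an extension of algebraically closed fields of characteristic zero of transcendence degree $n$, $1\le n\le\infty$, and $G=G_{F|k}$. Let $A\Pi$ be the set of algebraically closed subfields of $F$ containing $k$ and of finite transcendence degree over $k$. There is a surjective, inclusion-reversing morphism of commutative associative unital monoids $$\alpha:\{\text{open subgroups of }G\}\longrightarrow A\Pi$$ (where the monoid operation on the left is intersection, with identity $G$, and on $A\Pi$ it is $(L_1,L_2)\mapsto\overline{L_1L_2}$, the algebraic closure in $F$ of the compositum, with identity $k$), uniquely determined by either of the following equivalent conditions, imposed for every open subgroup $H\subseteq G$: (a) $G_{F|\alpha(H)}$ is a normal subgroup of $H$ and, if possible (i.e. if some $L\in A\Pi$ with $L\ne F$ has $G_{F|L}$ a normal subgroup of $H$), $\alpha(H)\neq F$; (b) $G_{F|\alpha(H)}\subseteq H$ and ${\rm tr.deg}(\alpha(H)|k)$ is minimal (among the $L\in A\Pi$ with $G_{F|L}\subseteq H$). In particular, for any $L\in A\Pi$ distinct from $F$ and $k$, the normalizer $G_{\{F,L\}|k}$ of $G_{F|L}$ in $G$ is maximal among the proper subgroups of $G$. If $n=\infty$, then any proper open subgroup $H$ of $G$ is contained in a maximal proper subgroup of $G$, and any maximal proper open subgroup of $G$ is of the form $G_{\{F,L\}|k}$ for some $L\in A\Pi$, $L\neq k$. Moreover, in this case $\alpha(H)=\alpha(N_GH)$, where $N_GH$ is the normalizer of $H$ in $G$.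
   Context: $n=\infty$ means countably infinite transcendence degree. For a subfield $K$ of $F$, $G_{F|K}$ is the group of field automorphisms of $F$ that are the identity on $K$; $G=G_{F|k}$. $G$ is a topological group in which the stabilizers of finite subsets of $F$ form a base of open subgroups (a base of neighbourhoods of $1$). $G_{\{F,L\}|k}=\{\sigma\in G\mid\sigma(L)=L\}$. $\overline{L}$ denotes the algebraic closure of $L$ in $F$. *)

(* Defs.v *)
From HB Require Import structures.
From mathcomp Require Import all_boot all_order all_algebra all_field.
From mathcomp Require Import finmap mpoly.
From mathcomp Require Import all_classical.
From mathcomp Require Import topology_structure.

Set Implicit Arguments.
Unset Strict Implicit.
Unset Printing Implicit Defensive.

Import GRing.Theory.

Local Open Scope classical_set_scope.
Local Open Scope card_scope.
Local Open Scope ring_scope.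

Section Subfields.
Variable F : fieldType.
Implicit Types (A B K L S : set F) (x y : F).

Definition subfield K : Prop := GRing.divring_closed (mem K).

Definition alg_closed_subfield K : Prop :=
  subfield K /\
  forall p : {poly F}, (forall i, K p`_i) -> (1 < size p)%N ->
    exists2 x, K x & root p x.

Definition algebraic_over K x : Prop :=
  exists p : {poly F}, [/\ forall i, K p`_i, p != 0 & root p x].

(* the algebraic closure of K in F *)
Definition alg_closure K : set F := [set x | algebraic_over K x].

(* The subfield K(S); when S is a subfield too, this is the compositum K S. *)
Definition adjoin K S : set F := smallest subfield (K `|` S).

Definition alg_independent K S : Prop :=
  forall (n : nat) (x : 'I_n -> F), injective x -> range x `<=` S ->
  forall p : {mpoly F[n]}, (forall m, K p@_m) -> p.@[x] = 0 -> p = 0.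

Definition transcendence_basis K L B : Prop :=
  [/\ B `<=` L, alg_independent K B & L `<=` alg_closure (adjoin K B)].

(* trdeg K L (Some m): L has transcendence degree m over K;
   trdeg K L None: L has countably infinite transcendence degree over K *)
Definition trdeg K L (n : option nat) : Prop :=
  exists2 B, transcendence_basis K L B &
    if n is Some m then B #= `I_m else B #= [set: nat].

Section SubfieldTheory.
Variables (K : set F) (HK : subfield K).

Lemma subfield1 : K 1.
Proof. by case: HK => h _ _; apply/set_mem. Qed.

Lemma subfieldB x y : K x -> K y -> K (x - y).
Proof. by case: HK => _ h _ Kx Ky; apply/set_mem/h; apply/mem_set. Qed.

Lemma subfield_div x y : K x -> K y -> K (x / y).
Proof. by case: HK => _ _ h Kx Ky; apply/set_mem/h; apply/mem_set. Qed.

Lemma subfield0 : K 0.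
Proof. by rewrite -(subrr 1); apply: subfieldB; apply: subfield1. Qed.

Lemma subfieldN x : K x -> K (- x).
Proof. by move=> Kx; rewrite -sub0r; apply: subfieldB => //; exact: subfield0. Qed.

Lemma subfieldD x y : K x -> K y -> K (x + y).
Proof.
by move=> Kx Ky; rewrite -[y]opprK; apply: subfieldB => //; apply: subfieldN.
Qed.

Lemma subfieldV x : K x -> K x^-1.
Proof.
by move=> Kx; rewrite -[x^-1]mul1r; apply: subfield_div => //; exact: subfield1.
Qed.

Lemma subfieldM x y : K x -> K y -> K (x * y).
Proof.
by move=> Kx Ky; rewrite -[y]invrK; apply: subfield_div => //; apply: subfieldV.
Qed.

Lemma subfieldX x n : K x -> K (x ^+ n).
Proof.
move=> Kx; elim: n => [|n IH]; first by rewrite expr0; exact: subfield1.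
by rewrite exprS; apply: subfieldM.
Qed.

Lemma subfield_sum (I : Type) (r : seq I) (P : pred I) (f : I -> F) :
  (forall i, K (f i)) -> K (\sum_(i <- r | P i) f i).
Proof. by move=> Kf; elim/big_ind: _; [exact: subfield0|exact: subfieldD|]. Qed.

Lemma subfield_prod (I : Type) (r : seq I) (P : pred I) (f : I -> F) :
  (forall i, K (f i)) -> K (\prod_(i <- r | P i) f i).
Proof. by move=> Kf; elim/big_ind: _; [exact: subfield1|exact: subfieldM|]. Qed.

Definition subfield_pred of subfield K : {pred F} := fun x => x \in K.

HB.instance Definition _ :=
  GRing.isDivringClosed.Build F (subfield_pred HK) HK.

Record subfield_type := SubfieldType
  { subfield_val :> F; _ : subfield_val \in subfield_pred HK }.

HB.instance Definition _ := [isSub for subfield_val].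
HB.instance Definition _ := [Choice of subfield_type by <:].
HB.instance Definition _ := [SubChoice_isSubIntegralDomain of subfield_type by <:].
HB.instance Definition _ := [SubIntegralDomain_isSubField of subfield_type by <:].

Lemma algebraic_overP x :
  algebraic_over K x <-> algebraicOver (val : subfield_type -> F) x.
Proof.
split=> [[p [Kp p0 px]]|[q q0 qx]].
  have sz i : p`_i \in subfield_pred HK by apply/mem_set.
  pose q := \poly_(i < size p) (SubfieldType (sz i)).
  have E : map_poly (val : subfield_type -> F) q = p.
    apply/polyP => i; rewrite coef_map coef_poly.
    by case: ltnP => // hi; rewrite nth_default ?rmorph0.
  exists q; rewrite ?E //.
  by apply: contraNneq p0 => q0; rewrite -E q0 rmorph0.
exists (map_poly val q); split => //; last by rewrite map_poly_eq0.
by move=> i; rewrite coef_map /=; apply/set_mem; case: (q`_i).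
Qed.

Lemma subfield_alg_closure : subfield (alg_closure K).
Proof.
split; first by apply/mem_set/algebraic_overP; exact: algebraic1.
- move=> x y /set_mem/algebraic_overP ax /set_mem/algebraic_overP ay.
  by apply/mem_set/algebraic_overP; exact: algebraic_sub.
- move=> x y /set_mem/algebraic_overP ax /set_mem/algebraic_overP ay.
  by apply/mem_set/algebraic_overP; exact: algebraic_div.
Qed.

Lemma sub_alg_closure : K `<=` alg_closure K.
Proof.
move=> x Kx; exists ('X - x%:P); split; last by rewrite root_XsubC.
- move=> i; rewrite coefB coefX coefC; apply: subfieldB.
  + by case: eqP => _; [exact: subfield1|exact: subfield0].
  + by case: eqP => _ //; exact: subfield0.
- by rewrite polyXsubC_eq0.
Qed.

Lemma alg_closure_root (p : {poly F}) x :
  (forall i, alg_closure K p`_i) -> p != 0 -> root p x -> alg_closure K x.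
Proof.
move=> Kp p0 px; apply/algebraic_overP/integral_algebraic.
apply: (integral_root p0 px) => _ /(nthP 0)[i _ <-].
by have /algebraic_overP/integral_algebraic := Kp i.
Qed.

Lemma alg_closure_idem : alg_closure (alg_closure K) `<=` alg_closure K.
Proof. by move=> x [p [Kp p0 px]]; exact: alg_closure_root Kp p0 px. Qed.

End SubfieldTheory.

Lemma alg_closureS A B : A `<=` B -> alg_closure A `<=` alg_closure B.
Proof. by move=> AB x [p [Kp p0 px]]; exists p; split => // i; exact: AB. Qed.

Lemma subfield_smallest S : subfield (smallest subfield S).
Proof.
split; first by apply/mem_set => K [/subfield1].
- move=> x y /set_mem Hx /set_mem Hy; apply/mem_set => K HK.
  by apply: (subfieldB HK.1); [exact: Hx|exact: Hy].
- move=> x y /set_mem Hx /set_mem Hy; apply/mem_set => K HK.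
  by apply: (subfield_div HK.1); [exact: Hx|exact: Hy].
Qed.

(* the algebraic closure in F of the subfield generated by S *)
Definition acl S : set F := alg_closure (smallest subfield S).

Lemma subfield_acl S : subfield (acl S).
Proof. exact/subfield_alg_closure/subfield_smallest. Qed.

Lemma sub_acl S : S `<=` acl S.
Proof.
move=> x Sx; apply: (sub_alg_closure (subfield_smallest S)).
exact: sub_gen_smallest.
Qed.

Lemma acl_sub A B : A `<=` acl B -> acl A `<=` acl B.
Proof.
move=> AB; apply: subset_trans (alg_closure_idem (subfield_smallest B)).
by apply: alg_closureS; apply: smallest_sub => //; exact: subfield_acl.
Qed.

Lemma aclS A B : A `<=` B -> acl A `<=` acl B.
Proof. by move=> AB; apply: acl_sub; exact: subset_trans (@sub_acl B). Qed.

Lemma acl_setUr A B : acl (A `|` acl B) = acl (A `|` B).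
Proof.
apply/seteqP; split; apply: acl_sub.
- rewrite subUset; split; last by apply: aclS => x; right.
  by apply: subset_trans (@sub_acl _) => x; left.
- apply: subset_trans (@sub_acl _) => x [?|/sub_acl]; by [left|right].
Qed.

Lemma acl_setUl A B : acl (acl A `|` B) = acl (A `|` B).
Proof. by rewrite setUC acl_setUr setUC. Qed.

Lemma acl_id K : alg_closed_subfield K -> acl K = K.
Proof.
move=> [HK clK]; apply/seteqP; split; last exact: sub_acl.
rewrite /acl (smallest_id HK) => x [p [Kp p0 px]].
have [m] := ubnP (size p); elim: m => // m IH in p Kp p0 px *.
rewrite ltnS => szp.
have sz1 : (1 < size p)%N by exact: root_size_gt1 px.
have [y Ky py] := clK p Kp sz1.
have [->//|xy] := eqVneq x y.
move: py => /factor_theorem[q pE].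
have q0 : q != 0 by apply: contraNneq p0 => q0; rewrite pE q0 mul0r.
have qx : root q x.
  move: px; rewrite pE rootM root_XsubC => /orP[//|/eqP xE].
  by rewrite xE eqxx in xy.
have szE : size p = (size q).+1 by rewrite pE size_Mmonic ?monicXsubC// size_XsubC addn2.
apply: (IH q) => //; last by rewrite -szE.
have qS i : q`_i = p`_i.+1 + q`_i.+1 * y.
  by rewrite pE mulrBr coefB coefMX /= coefMC subrK.
have H j : forall i, (size q <= i + j)%N -> K q`_i.
  elim: j => [i|j IHj i] hi.
    by rewrite addn0 in hi; rewrite nth_default//; exact: subfield0.
  rewrite qS; apply: subfieldD => //; apply: subfieldM => //.
  by apply: IHj; rewrite addSnnS.
by move=> i; apply: (H (size q)); rewrite leq_addl.
Qed.

Section FiniteTrdeg.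
Variables (K : set F) (HK : subfield K).

Lemma mnm_rcons_max n (m : 'X_{1..n}) i : [multinom of rcons m i] ord_max = i.
Proof.
by rewrite multinomE (tnth_nth 0%N) /= nth_rcons size_tuple ltnn eqxx.
Qed.

Lemma mnm_rcons_widen n (m : 'X_{1..n}) i (j : 'I_n) :
  [multinom of rcons m i] (widen_ord (leqnSn n) j) = m j.
Proof.
by rewrite multinomE (tnth_nth 0%N) /= nth_rcons size_tuple ltn_ord (mnm_nth 0%N).
Qed.

Lemma ord_max_or_widen n (j : 'I_n.+1) :
  j = ord_max \/ exists j', j = widen_ord (leqnSn n) j'.
Proof.
case: (ltnP j n) => jn; [right; exists (Ordinal jn)|left]; apply/val_inj => //.
by apply/eqP; rewrite eqn_leq /= jn -ltnS ltn_ord.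
Qed.

Lemma muni_coef n (p : {mpoly F[n.+1]}) i (m : 'X_{1..n}) :
  (muni p)`_i@_m = p@_[multinom of rcons m i].
Proof.
set M := [multinom of _].
have ME (m' : 'X_{1..n.+1}) : (m' == M) =
  ([multinom (m' (widen_ord (leqnSn n) j)) | j < n] == m) && (m' ord_max == i).
  apply/eqP/andP => [->|[/eqP mE /eqP iE]].
    split; apply/eqP; last exact: mnm_rcons_max.
    by apply/mnmP => j; rewrite mnmE mnm_rcons_widen.
  apply/mnmP => j; have [->|[j' ->]] := ord_max_or_widen j.
    by rewrite mnm_rcons_max.
  by rewrite mnm_rcons_widen -mE mnmE.
rewrite muniE coef_sum raddf_sum /= [in RHS](mpolyE p) raddf_sum /=.
apply: eq_bigr => m' _; rewrite coefZ coefXn !mcoeffZ mcoeffX ME.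
rewrite [in LHS]eq_sym.
case: (m' ord_max == i); rewrite ?andbT ?andbF; last by rewrite mulr0 mcoeff0 mulr0.
by rewrite mulr1 mcoeffZ mcoeffX.
Qed.

Lemma meval_muni n (p : {mpoly F[n.+1]}) (x : 'I_n.+1 -> F) :
  p.@[x] = (map_poly (meval (fun j => x (widen_ord (leqnSn n) j)))
             (muni p)).[x ord_max].
Proof.
rewrite muniE raddf_sum horner_sum mevalE; apply: eq_bigr => m _.
rewrite /= map_polyZ map_polyXn hornerZ hornerXn /= mevalZ mevalX big_ord_recr /=.
rewrite mulrA; congr (_ * _ * _).
by apply: eq_bigr => j _; rewrite mnmE.
Qed.

Lemma mpoly0_const (p : {mpoly F[0]}) (x : 'I_0 -> F) : p.@[x] = 0 -> p = 0.
Proof.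
have pE : p = (p@_0%MM)%:MP.
  by apply/mpolyP => m; rewrite mcoeffC; have -> : m = 0%MM;
    [apply/mnmP => -[]|rewrite eqxx mulr1].
by rewrite pE mevalC => ->; rewrite mpolyC0.
Qed.

Lemma algebraic_dependence n (x : 'I_n -> F) (p : {mpoly F[n]}) :
  (forall m, K p@_m) -> p != 0 -> p.@[x] = 0 ->
  exists i, acl (K `|` [set x j | j in [set j | j != i]]) (x i).
Proof.
elim: n x p => [x p _ p0 /mpoly0_const p0'|n IH x p Kp p0 px].
  by rewrite p0' eqxx in p0.
pose w (j : 'I_n) := widen_ord (leqnSn n) j.
pose q := map_poly (meval (x \o w)) (muni p).
have qx : root q (x ord_max) by apply/rootP; rewrite /q -meval_muni.
have Kc i m : K (muni p)`_i@_m by rewrite muni_coef.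
have [q0|q0] := eqVneq q 0; last first.
  exists ord_max; exists q; split => // i; set S := _ `|` _.
  have HS := subfield_smallest S.
  rewrite coef_map /= mevalE; apply: (subfield_sum HS) => m.
  apply: (subfieldM HS); first by apply: (@sub_gen_smallest _ subfield S); left; rewrite muni_coef.
  apply: (subfield_prod HS) => j; apply: (subfieldX HS).
  apply: (@sub_gen_smallest _ subfield S); right; exists (w j) => //=.
  by rewrite neq_ltn /= ltn_ord.
have [i ci] : exists i, (muni p)`_i != 0.
  apply: contrapT => H; move/eqP: p0; apply; apply/mpolyP => m.
  rewrite mcoeff0; pose m' := [multinom m (w j) | j < n].
  have -> : m = [multinom of rcons m' (m ord_max)].
    apply/mnmP => j; have [->|[j' ->]] := ord_max_or_widen j.
      by rewrite mnm_rcons_max.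
    by rewrite mnm_rcons_widen mnmE.
  rewrite -muni_coef.
  suff -> : (muni p)`_(m ord_max) = 0 by rewrite mcoeff0.
  by apply/eqP; apply: contrapT => /negP ?; apply: H; exists (m ord_max).
have cx : ((muni p)`_i).@[x \o w] = 0.
  by have := coef_map (meval (x \o w)) (muni p) i; rewrite -/q q0 coef0 => <-.
have [j Hj] := IH _ _ (Kc i) ci cx.
by exists (w j); apply: aclS Hj; apply: setUS => _ [l lj <-]; exists (w l).
Qed.

Lemma finite_trdeg L S : finite_set S -> L = acl (K `|` S) ->
  exists m, trdeg K L (Some m).
Proof.
move=> Sfin LE; have [N] := ubnP #|` fset_set S|.
elim: N => // N IH in S Sfin LE *; rewrite ltnS => SN.
have [ind|] := pselect (alg_independent K S).
  have /finite_setP[m Sm] := Sfin.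
  exists m, S => //; split => //; rewrite LE //.
  by apply: subset_trans (@sub_acl _) => x; right.
move=> /existsNP[n] /existsNP[x] /not_implyP[xinj] /not_implyP[xS].
move=> /existsNP[p] /not_implyP[Kp] /not_implyP[px] /eqP p0.
have [i Hi] := algebraic_dependence Kp p0 px.
have Sxi : S (x i) by apply: xS; exists i.
have Hi' : acl (K `|` (S `\ x i)) (x i).
  apply: aclS Hi; apply: setUS => _ [j ji <-]; split; first by apply: xS; exists j.
  by move=> /xinj /= E; rewrite /= E eqxx in ji.
apply: (IH (S `\ x i)); first exact: finite_setD.
- rewrite LE; apply/seteqP; split; apply: acl_sub.
  + move=> y [Ky|Sy]; first by apply: sub_acl; left.
    have [->//|yx] := eqVneq y (x i).
    by apply: sub_acl; right; split => //; exact/eqP.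
  + by apply: subset_trans (@sub_acl _); apply: setUS => y [].
- rewrite fset_setD1//; apply: leq_trans SN.
  by rewrite (cardfsD1 (x i) (fset_set S)) in_fset_set// mem_set.
Qed.

End FiniteTrdeg.
End Subfields.

Record acSubfield (F : fieldType) := AcSubfield
  { ac_set :> set F; ac_setP : alg_closed_subfield ac_set }.

(* The set written A Pi: algebraically closed subfields of F containing k, of
   finite transcendence degree over k. *)
Record APi (F : fieldType) (k : acSubfield F) := MkAPi
  { APi_field :> acSubfield F;
    APi_sub : k `<=` APi_field;
    APi_trdeg : exists m, trdeg k APi_field (Some m) }.

Section APiMonoid.
Variables (F : closedFieldType) (k : acSubfield F).

Lemma APi_eq (L1 L2 : APi k) : L1 = L2 :> set F -> L1 = L2.
Proof.
case: L1 L2 => [[L1 c1] s1 t1] [[L2 c2] s2 t2] /= E.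
move: c1 s1 t1; rewrite {}E => c1 s1 t1; rewrite (Prop_irrelevance c1 c2) in s1 t1 *.
by rewrite (Prop_irrelevance s1 s2) (Prop_irrelevance t1 t2).
Qed.

Lemma alg_closed_acl (S : set F) : alg_closed_subfield (acl S).
Proof.
split=> [|p Kp sz]; first exact: subfield_acl.
have /closed_rootP[x px] : size p != 1%N by rewrite gtn_eqF.
exists x => //; apply: (alg_closure_root (subfield_smallest S)) Kp _ px.
by rewrite -size_poly_gt0 (ltn_trans _ sz).
Qed.

Lemma APi_acl (L : APi k) : exists2 S, finite_set S & L = acl (k `|` S) :> set F.
Proof.
case: (APi_trdeg L) => m [B [BL _ LB] Bm]; exists B; first by apply/finite_setP; exists m.
apply/seteqP; split => //; rewrite -[X in _ `<=` X](acl_id (ac_setP L)); apply: aclS.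
by rewrite subUset; split => //; exact: APi_sub.
Qed.

Let trdeg0 : exists m, trdeg k k (Some m).
Proof.
apply: (@finite_trdeg _ _ _ set0) => //.
by rewrite setU0 acl_id //; exact: ac_setP.
Qed.

Definition APi0 : APi k := MkAPi (@subset_refl _ k) trdeg0.

Section Join.
Variables L1 L2 : APi k.

Definition join_set : set F := alg_closure (adjoin L1 L2).

Let join_closed : alg_closed_subfield join_set.
Proof. exact: alg_closed_acl. Qed.

Let join_sub : k `<=` join_set.
Proof.
by apply: subset_trans (@sub_acl _ _) => x kx; left; exact: (APi_sub L1).
Qed.

Let join_trdeg : exists m, trdeg k join_set (Some m).
Proof.
have [S1 f1 E1] := APi_acl L1; have [S2 f2 E2] := APi_acl L2.
apply: (@finite_trdeg _ _ _ (S1 `|` S2)); first by rewrite finite_setU.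
rewrite /join_set -/(acl _) E1 E2 acl_setUl acl_setUr.
by congr acl; rewrite setUACA setUid.
Qed.

Definition APi_join : APi k :=
  @MkAPi F k (AcSubfield join_closed) join_sub join_trdeg.

End Join.

Lemma APi_joinA : associative APi_join.
Proof.
move=> L1 L2 L3; apply: APi_eq.
by rewrite /= /join_set -!/(acl _) acl_setUl acl_setUr setUA.
Qed.

Lemma APi_joinC : commutative APi_join.
Proof. by move=> L1 L2; apply: APi_eq; rewrite /= /join_set /adjoin setUC. Qed.

Lemma APi_join0 : left_id APi0 APi_join.
Proof.
move=> L; apply: APi_eq; rewrite /= /join_set -/(acl _).
by rewrite (setUidr (@APi_sub _ _ L)) acl_id //; exact: ac_setP.
Qed.

HB.instance Definition _ := gen_eqMixin (APi k).
HB.instance Definition _ := gen_choiceMixin (APi k).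
(* additive notation: L1 + L2 is the algebraic closure of the compositum of L1
   and L2, and 0 is k *)
HB.instance Definition _ :=
  GRing.isNmodule.Build (APi k) APi_joinA APi_joinC APi_join0.

Lemma APi_addE (L1 L2 : APi k) :
  L1 + L2 = alg_closure (adjoin L1 L2) :> set F.
Proof. by []. Qed.

Lemma APi_0E : (0 : APi k) = k :> set F.
Proof. by []. Qed.

End APiMonoid.

(* the automorphism group of F over k *)
Record fieldAut (F : fieldType) (k : set F) := FieldAut
  { fieldAut_fun :> F -> F;
    fieldAutP : [/\ zmod_morphism fieldAut_fun, monoid_morphism fieldAut_fun,
                    bijective fieldAut_fun & {in k, fieldAut_fun =1 id}] }.

Section AutGroup.
Variables (F : fieldType) (k : set F).
Implicit Types s t : fieldAut k.

Lemma fieldAut_eq s t : s =1 t -> s = t.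
Proof.
case: s t => [f Pf] [g Pg] /= /funext E; move: Pf; rewrite {}E => Pf.
by rewrite (Prop_irrelevance Pf Pg).
Qed.

HB.instance Definition _ s := GRing.isZmodMorphism.Build F F s
  (let: And4 h _ _ _ := fieldAutP s in h).
HB.instance Definition _ s := GRing.isMonoidMorphism.Build F F s
  (let: And4 _ h _ _ := fieldAutP s in h).

Lemma fieldAut_fix s x : k x -> s x = x.
Proof. by case: (fieldAutP s) => _ _ _ h kx; apply: h; apply/mem_set. Qed.

Let inv_ex s : exists g : F -> F, cancel s g /\ cancel g s.
Proof. by case: (fieldAutP s) => _ _ [g h1 h2] _; exists g. Qed.

Let inv_fun s : F -> F := sval (cid (inv_ex s)).

Let funK s : cancel s (inv_fun s).
Proof. by rewrite /inv_fun; case: cid => g []. Qed.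

Let inv_funK s : cancel (inv_fun s) s.
Proof. by rewrite /inv_fun; case: cid => g []. Qed.

Let one_subproof : [/\ zmod_morphism (@id F), monoid_morphism (@id F),
  bijective (@id F) & {in k, @id F =1 id}].
Proof. by split => //; exists id. Qed.

Let mul_subproof s t : [/\ zmod_morphism (s \o t), monoid_morphism (s \o t),
  bijective (s \o t) & {in k, s \o t =1 id}].
Proof.
split; [exact: raddfB|by split; [exact: rmorph1|exact: rmorphM]| |].
- by exists (inv_fun t \o inv_fun s) => x; rewrite /= ?funK ?inv_funK.
- by move=> x /set_mem kx /=; rewrite !fieldAut_fix.
Qed.

Let inv_subproof s : [/\ zmod_morphism (inv_fun s), monoid_morphism (inv_fun s),
  bijective (inv_fun s) & {in k, inv_fun s =1 id}].
Proof.
split.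
- exact: can2_zmod_morphism (funK s) (inv_funK s).
- exact: can2_monoid_morphism (funK s) (inv_funK s).
- by exists s; [exact: inv_funK|exact: funK].
- by move=> x /set_mem kx; rewrite -{1}(fieldAut_fix s kx) funK.
Qed.

Definition fieldAut1 : fieldAut k := FieldAut one_subproof.
Definition fieldAut_mul s t : fieldAut k := FieldAut (mul_subproof s t).
Definition fieldAut_inv s : fieldAut k := FieldAut (inv_subproof s).

Let mulA : associative fieldAut_mul.
Proof. by move=> s t u; exact: fieldAut_eq. Qed.
Let mul1s : left_id fieldAut1 fieldAut_mul.
Proof. by move=> s; exact: fieldAut_eq. Qed.
Let muls1 : right_id fieldAut1 fieldAut_mul.
Proof. by move=> s; exact: fieldAut_eq. Qed.
Let mulVs : left_inverse fieldAut1 fieldAut_inv fieldAut_mul.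
Proof. by move=> s; apply: fieldAut_eq => x; exact: funK. Qed.
Let mulsV : right_inverse fieldAut1 fieldAut_inv fieldAut_mul.
Proof. by move=> s; apply: fieldAut_eq => x; exact: inv_funK. Qed.

HB.instance Definition _ := gen_eqMixin (fieldAut k).
HB.instance Definition _ := gen_choiceMixin (fieldAut k).
HB.instance Definition _ :=
  isGroup.Build (fieldAut k) mulA mul1s muls1 mulVs mulsV.

(* pointwise stabilizer; for a field L containing k, fixator k L is G_{F|L} *)
Definition fixator (S : set F) : set (fieldAut k) :=
  [set s | forall x, S x -> s x = x].

(* G_{{F,L}|k} *)
Definition set_stabilizer (L : set F) : set (fieldAut k) := [set s | s @` L = L].

Let aut_nbhs s : set_system (fieldAut k) :=
  [set U | exists2 S : set F, finite_set S &
           forall t, fixator S t -> U (s * t)%g].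

HB.instance Definition _ := hasNbhs.Build (fieldAut k) aut_nbhs.

Let aut_nbhs_filter s : ProperFilter (nbhs s).
Proof.
split.
  by move=> [S _ /(_ 1%g)]; apply.
split.
- by exists set0.
- move=> U V [S fS SU] [T fT TV]; exists (S `|` T); first by rewrite finite_setU.
  by move=> t Ht; split; [apply: SU|apply: TV] => x ?; apply: Ht; [left|right].
- by move=> U V UV [S fS SU]; exists S => // t /SU/UV.
Qed.

Let aut_nbhs_singleton s (U : set (fieldAut k)) : nbhs s U -> U s.
Proof. by move=> [S _ /(_ 1%g)]; rewrite mulg1; apply. Qed.

Let aut_nbhs_nbhs s (U : set (fieldAut k)) : nbhs s U -> nbhs s (nbhs^~ U).
Proof.
move=> [S fS SU]; exists S => // t tS; exists S => // u uS.
by rewrite -mulgA; apply: SU => x Sx; rewrite -[RHS](tS x Sx) -{2}(uS x Sx).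
Qed.

HB.instance Definition _ := Nbhs_isNbhsTopological.Build (fieldAut k)
  aut_nbhs_filter aut_nbhs_singleton aut_nbhs_nbhs.

Lemma fieldAut_nbhsE s (U : set (fieldAut k)) : nbhs s U <->
  exists2 S : set F, finite_set S & forall t, fixator S t -> U (s * t)%g.
Proof. by []. Qed.

Lemma open_fixator (S : set F) : finite_set S -> open (fixator S).
Proof.
move=> fS; rewrite openE => s sS; exists S => // t tS x Sx.
by rewrite -[RHS](sS x Sx) -{2}(tS x Sx).
Qed.

End AutGroup.

Arguments fixator {F} k S _.
Arguments set_stabilizer {F} k L _.

Section Subgroups.
Variable G : groupType.
Implicit Types M N H : set G.

Definition subgroup H : Prop := group_closed (mem H).

Definition normalizer H : set G := [set s | [set (h ^ s)%g | h in H] = H].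

Definition normal_subgroup N H : Prop :=
  [/\ subgroup N, subgroup H, N `<=` H & H `<=` normalizer N].

Definition maximal_subgroup M : Prop :=
  [/\ subgroup M, M <> [set: G] &
      forall H, subgroup H -> M `<=` H -> H = M \/ H = [set: G]].

Lemma subgroupP H : subgroup H <->
  [/\ H 1%g, forall s t, H s -> H t -> H (s * t)%g & forall s, H s -> H s^-1%g].
Proof.
split=> [HH|[H1 HM HV]].
  have HM := group_closedM HH; have HV := group_closedV HH.
  split; first by case: HH => /set_mem.
  - by move=> s t Hs Ht; apply/set_mem/HM; apply/mem_set.
  - by move=> s Hs; apply/set_mem/HV; apply/mem_set.
split; first exact/mem_set.
by move=> s t /set_mem Hs /set_mem Ht; apply/mem_set/HM => //; exact: HV.
Qed.

Lemma subgroupT : subgroup [set: G].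
Proof. by apply/subgroupP. Qed.

Lemma subgroupI H1 H2 : subgroup H1 -> subgroup H2 -> subgroup (H1 `&` H2).
Proof.
move=> /subgroupP[a1 b1 c1] /subgroupP[a2 b2 c2]; apply/subgroupP; split => //.
- by move=> s t [? ?] [? ?]; split; [exact: b1|exact: b2].
- by move=> s [? ?]; split; [exact: c1|exact: c2].
Qed.

Lemma subgroup_normalizer H : subgroup (normalizer H).
Proof.
apply/subgroupP; split => [|s t Es Et|s Es]; rewrite /normalizer /=.
- by apply/seteqP; split=> [_ [h Hh <-]|h Hh]; [|exists h]; rewrite ?conjg1.
- rewrite -[RHS]Et -[in RHS]Es image_comp.
  by apply: eq_imagel => h _; rewrite /= conjgM.
- rewrite -[in LHS]Es image_comp -[RHS]image_id.
  by apply: eq_imagel => h _; rewrite /= conjgK.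
Qed.

Lemma sub_normalizer H : subgroup H -> H `<=` normalizer H.
Proof.
move=> /subgroupP[H1 HM HV] s Hs; apply/seteqP; split.
  by move=> _ [h Hh <-]; exact: HM (HV _ Hs) (HM _ _ Hh Hs).
move=> h Hh; exists (h ^ s^-1)%g; last by rewrite conjgKV.
exact: HM (HV _ (HV _ Hs)) (HM _ _ Hh (HV _ Hs)).
Qed.

End Subgroups.

Record openSubgroup (F : fieldType) (k : set F) := OpenSubgroup
  { openSubgroup_set :> set (fieldAut k);
    openSubgroupP : subgroup openSubgroup_set;
    openSubgroup_open : open openSubgroup_set }.

Arguments openSubgroup_open {F k} H : rename.

Section OpenSubgroups.
Variables (F : fieldType) (k : set F).
Implicit Types H : openSubgroup k.

Lemma openSubgroup_eq H1 H2 : H1 = H2 :> set _ -> H1 = H2.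
Proof.
case: H1 H2 => [H1 s1 o1] [H2 s2 o2] /= E; move: s1 o1; rewrite {}E => s1 o1.
by rewrite (Prop_irrelevance s1 s2) (Prop_irrelevance o1 o2).
Qed.

Definition openSubgroupT : openSubgroup k :=
  OpenSubgroup (@subgroupT _) openT.

Definition openSubgroupI H1 H2 : openSubgroup k :=
  OpenSubgroup (subgroupI (openSubgroupP H1) (openSubgroupP H2))
               (@openI _ _ _ (openSubgroup_open H1) (openSubgroup_open H2)).

Let openSubgroupIA : associative openSubgroupI.
Proof. by move=> A B C; apply: openSubgroup_eq; exact: setIA. Qed.
Let openSubgroupIC : commutative openSubgroupI.
Proof. by move=> A B; apply: openSubgroup_eq; exact: setIC. Qed.
Let openSubgroupTI : left_id openSubgroupT openSubgroupI.
Proof. by move=> A; apply: openSubgroup_eq; exact: setTI. Qed.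

HB.instance Definition _ := gen_eqMixin (openSubgroup k).
HB.instance Definition _ := gen_choiceMixin (openSubgroup k).
(* additive notation: H1 + H2 is the intersection of H1 and H2, and 0 is the
   whole group *)
HB.instance Definition _ := GRing.isNmodule.Build (openSubgroup k)
  openSubgroupIA openSubgroupIC openSubgroupTI.

Lemma openSubgroup_addE H1 H2 : H1 + H2 = H1 `&` H2 :> set (fieldAut k).
Proof. by []. Qed.

Lemma openSubgroup_0E : (0 : openSubgroup k) = [set: fieldAut k] :> set _.
Proof. by []. Qed.

Lemma open_supergroup H (N : set (fieldAut k)) :
  subgroup N -> H `<=` N -> open N.
Proof.
move=> /subgroupP[_ NM _] HN; rewrite openE => s Ns.
have /subgroupP[H1 _ _] := openSubgroupP H.
have := openSubgroup_open H; rewrite openE => /(_ _ H1)[S fS SH].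
by exists S => // t /SH; rewrite mul1g => /HN; exact: NM.
Qed.

Definition openSubgroup_normalizer H : openSubgroup k :=
  OpenSubgroup (subgroup_normalizer H)
    (open_supergroup (subgroup_normalizer H) (sub_normalizer (openSubgroupP H))).

End OpenSubgroups.

Section Conditions.
Variables (F : closedFieldType) (k : acSubfield F).
Implicit Types (H : openSubgroup k) (L : APi k).

(* the premise of the implication is the proviso `if possible' *)
Definition condition_a H L : Prop :=
  normal_subgroup (fixator k L) H /\
  ((exists L' : APi k,
      (L' : set F) <> setT /\ normal_subgroup (fixator k L') H) ->
   (L : set F) <> setT).

Definition condition_b H L : Prop :=
  fixator k L `<=` H /\
  exists m, trdeg k L (Some m) /\
    forall (L' : APi k) m', fixator k L' `<=` H -> trdeg k L' (Some m') ->
      (m <= m')%N.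

End Conditions.

(* Main.v *)
(* Algebraic closure is a pregeometry, and a back-and-forth argument shows that
   G_{F|K} acts transitively on K-independent tuples of a given length. The key
   point is that for any subgroup H of G containing some G_{F|A}, the fields L
   with G_{F|L} contained in H have a smallest element alpha(H). Let L be such a
   field of minimal dimension over a base K, and suppose that another such field
   B does not contain L. Moving L by G_{F|B} and G_{F|L}, and using induction
   over the bases K(z), one sees that the images of L partition F outside K into
   closed fields that pairwise meet in K. Any two of them, X and Y, are linearly
   disjoint over K, and X lies in the closure of Y(x) for each x in X outside K;
   hence X is the closure of K(x). A g in G_{F|K} then agrees on L with an
   automorphism fixing some image X of L that is disjoint from both L and gL, so
   g lies in H, and K itself is a smaller field with G_{F|K} contained in H. *)
Require Import Defs.
From HB Require Import structures.
From mathcomp Require Import all_boot all_order all_algebra all_field.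
From mathcomp Require Import finmap mpoly.
From mathcomp Require Import all_classical.
From mathcomp Require Import topology_structure.
From mathcomp Require Import ring zify.

Set Implicit Arguments.
Unset Strict Implicit.
Unset Printing Implicit Defensive.

Import GRing.Theory.

Local Open Scope classical_set_scope.
Local Open Scope ring_scope.

(** The obstacle is that algebraic closure is in general not modular: two closed fields A and B may
    meet in a field smaller than their dimensions predict, so no dimension count shows that G_{F|A}
    and G_{F|B} generate a group containing G_{F|K} for a smaller K. Field structure has to enter,
    and it does so as linear disjointness, which Artin's argument extracts from the automorphisms
    that fix one minimal field and preserve another. It serves twice: it lowers the coefficients of
    an algebraic relation from Y to K, so that minimal fields turn out to be one-dimensional, and it
    allows an automorphism of one field to be glued to the identity of another. Two minimal fields
    sharing a point z outside K coincide because over the closure of K(z) both have dimension one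
    less; the smallest field is known to exist there, and minimality over K forbids it to be smaller
    than either. F may have finite transcendence degree, so a point outside two proper fields cannot
    be had by a dimension count; it comes from the fact that a field is not the union of two proper
    subfields. *)

(** * Algebraic closure as a pregeometry: exchange and bases *)

Section AlgebraicClosure.
Variable F : fieldType.
Implicit Types (A B K L S : set F) (x y : F) (s t : seq F).

Lemma acl_acl S : acl (acl S) = acl S.
Proof. by apply/seteqP; split; [exact: acl_sub|exact: sub_acl]. Qed.

(** No closure under inverses is asked: the instances are sets of values of polynomials and domains
    of partial isomorphisms. *)
Record subring_set A : Prop := SubringSet {
  subring_set1 : A 1;
  subring_setB : forall x y, A x -> A y -> A (x - y);
  subring_setM : forall x y, A x -> A y -> A (x * y) }.

Lemma subring_set0 A : subring_set A -> A 0.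
Proof. by case=> A1 AB _; rewrite -(subrr 1); exact: AB. Qed.

Lemma smallest_subfield_subring A x : subring_set A -> smallest (@subfield F) A x ->
  exists a b, [/\ A a, A b, b != 0 & x = a / b].
Proof.
move=> HA; have [A1 AB AM] := HA.
pose Q := [set x | exists a b, [/\ A a, A b, b != 0 & x = a / b]].
suff Qf : subfield Q by apply: (smallest_sub Qf) => a Aa; exists a, 1; rewrite oner_eq0 divr1.
split; first by apply/mem_set; exists 1, 1; rewrite oner_eq0 divr1.
- move=> _ _ /set_mem[a [b [Aa Ab b0 ->]]] /set_mem[c [d [Ac Ad d0 ->]]].
  apply/mem_set; exists (a * d - c * b), (b * d); split; [|exact: AM|by rewrite mulf_neq0|].
    by apply: AB; exact: AM.
  by field; rewrite b0 d0.
- move=> _ _ /set_mem[a [b [Aa Ab b0 ->]]] /set_mem[c [d [Ac Ad d0 ->]]].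
  apply/mem_set; have [->|c0] := eqVneq c 0.
    by exists 0, 1; rewrite oner_eq0 mul0r invr0 mulr0 mul0r; split => //; exact: subring_set0.
  exists (a * d), (b * c); split; [exact: AM|exact: AM|by rewrite mulf_neq0|].
  by field; rewrite b0 c0 d0.
Qed.

(** The coefficients are fractions over [A]; a common denominator, built one coefficient at a time,
    clears them. *)
Lemma acl_subring A x : subring_set A -> acl A x ->
  exists p : {poly F}, [/\ forall i, A p`_i, p != 0 & root p x].
Proof.
move=> HA [p [Kp p0 px]]; have [A1 AB AM] := HA.
have [d [Ad d0 Hd]] : exists d, [/\ A d, d != 0 & forall i, (i < size p)%N -> A (d * p`_i)].
  elim: (size p) => [|n [d [Ad d0 Hd]]]; first by exists 1; rewrite oner_eq0.
  have [a [b [Aa Ab b0 pE]]] := smallest_subfield_subring HA (Kp n).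
  exists (b * d); rewrite mulf_neq0//; split => //; first exact: AM.
  move=> i; rewrite ltnS leq_eqVlt => /orP[/eqP->|/Hd Ai].
    rewrite pE (_ : b * d * _ = d * a); first exact: AM.
    by field.
  by rewrite -mulrA; exact: AM.
exists (d *: p); split; last by rewrite rootZ.
- move=> i; rewrite coefZ; have [/Hd//|ip] := ltnP i (size p).
  by rewrite nth_default// mulr0; exact: subring_set0.
- by rewrite scaler_eq0 negb_or d0.
Qed.

Lemma subring_horner K a : subfield K ->
  subring_set [set p.[a] | p in [set p : {poly F} | forall i, K p`_i]].
Proof.
move=> HK; split.
- exists 1; last by rewrite hornerC.
  by move=> i; rewrite /= coefC; case: ifP => _; [exact: subfield1|exact: subfield0].
- move=> _ _ [p Kp <-] [q Kq <-]; exists (p - q); last by rewrite !hornerE.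
  by move=> i; rewrite /= coefB; apply: subfieldB.
- move=> _ _ [p Kp <-] [q Kq <-]; exists (p * q); last by rewrite !hornerE.
  by move=> i; rewrite /= coefM; apply: subfield_sum => // j; apply: subfieldM.
Qed.

(** Denominators are cleared over the ring K[a]. The outcome is a relation in two variables, which
    can be regrouped by powers of either [a] or [x]. *)
Lemma acl_adjoin1 K a x : subfield K -> acl (a |` K) x ->
  exists p : nat -> {poly F}, exists n, [/\ forall i j, K (p i)`_j,
    exists i : 'I_n, (p i).[a] != 0 & \sum_(i < n) (p i).[a] * x ^+ i = 0].
Proof.
move=> HK Hx.
pose A := [set p.[a] | p in [set p : {poly F} | forall i, K p`_i]].
have HA : subring_set A := subring_horner a HK.
have /(acl_subring HA)[p [Ap p0 /rootP px]] : acl A x.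
  apply: aclS Hx => y [->|Ky].
    exists 'X; last by rewrite hornerX.
    by move=> i /=; rewrite coefX; case: eqP => _; [exact: subfield1|exact: subfield0].
  exists y%:P; last by rewrite hornerC.
  by move=> i /=; rewrite coefC; case: ifP => _ //; exact: subfield0.
have /choice[q Hq] : forall i, exists q : {poly F}, (forall j, K q`_j) /\ q.[a] = p`_i.
  by move=> i; have [q ? ?] := Ap i; exists q.
exists q, (size p); split; first by move=> i j; have [] := Hq i.
- have s0 : (0 < size p)%N by rewrite size_poly_gt0.
  have lt : ((size p).-1 < size p)%N by rewrite prednK.
  by exists (Ordinal lt) => /=; have [_ ->] := Hq (size p).-1; rewrite lead_coef_eq0.
- by rewrite -[RHS]px horner_coef; apply: eq_bigr => i _; have [_ ->] := Hq i.
Qed.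

(** The relation of [b] over K[a] is reread as a polynomial in [a] over K[b]. *)
Lemma acl_exchange S a b :
  acl (a |` S) b -> ~ acl S b -> acl (b |` S) a.
Proof.
move=> Hb nb; set K := acl S; have HK : subfield K := subfield_acl S.
have [|p [n [Kp [i pi0] px]]] := @acl_adjoin1 K a b HK.
  by apply: aclS Hb => x [->|Sx]; [left|right; exact: sub_acl].
rewrite -acl_setUr.
pose q := \sum_(i < n) (p i) * (b ^+ i)%:P.
exists q; set B := _ `|` _; have HB := subfield_smallest B.
have KB x : K x -> smallest (@subfield F) B x.
  by move=> Kx; apply: (@sub_gen_smallest _ (@subfield F) B); right.
split.
- move=> j; rewrite coef_sum; apply: (subfield_sum HB) => l; rewrite coefMC.
  apply: (subfieldM HB); first by apply: KB; exact: Kp.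
  by apply: (subfieldX HB); apply: (@sub_gen_smallest _ (@subfield F) B); left.
(* Were [q] zero, its coefficient of degree [j] would be a nontrivial relation for [b] over [K]. *)
- have [j pj0] : exists j, (p i)`_j != 0.
    have p0 : p i != 0 by apply: contraNneq pi0 => ->; rewrite horner0.
    by exists (size (p i)).-1; rewrite lead_coef_eq0.
  apply/negP => /eqP q0; apply: nb.
  suff Kb : alg_closure K b.
    by rewrite -acl_acl; apply: alg_closureS Kb; exact: (@sub_gen_smallest _ (@subfield F)).
  exists (\poly_(l < n) (p l)`_j); split.
  + by move=> l; rewrite coef_poly; case: ifP => // _; exact: subfield0.
  + by apply/negP => /eqP/polyP/(_ i); rewrite coef_poly ltn_ord coef0 => /eqP; exact/negP.
  + apply/rootP; rewrite horner_poly -[RHS](coef0 F j) -q0 coef_sum.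
    by apply: eq_bigr => l _; rewrite coefMC.
- apply/rootP; rewrite horner_sum -[RHS]px; apply: eq_bigr => l _.
  by rewrite hornerM hornerC.
Qed.

(** Each entry has to avoid only the closure of the later ones, which suits induction; exchange
    makes the order immaterial. *)
Fixpoint indep K s : Prop :=
  if s is x :: s' then ~ acl (K `|` [set` s']) x /\ indep K s' else True.

Definition clo K s := acl (K `|` [set` s]).

Lemma clo_sub K s A : acl A = A -> K `<=` A -> [set` s] `<=` A -> clo K s `<=` A.
Proof. by move=> EA KA sA; rewrite -EA; apply: aclS; rewrite subUset. Qed.

Lemma sub_clo K s : K `<=` clo K s.
Proof. by apply: subset_trans (@sub_acl _ _) => x; left. Qed.

Lemma mem_clo K s : [set` s] `<=` clo K s.
Proof. by apply: subset_trans (@sub_acl _ _) => x; right. Qed.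

Lemma clo_cons K x s : clo K (x :: s) = acl (x |` clo K s).
Proof.
rewrite acl_setUr /clo setUCA; congr (acl (_ `|` _)); apply/seteqP; split=> y /=.
  by rewrite inE => /orP[/eqP|]; [left|right].
by move=> [->|ys]; rewrite inE ?eqxx // ys orbT.
Qed.

Lemma eq_clo K s t : s =i t -> clo K s = clo K t.
Proof. by move=> E; congr (acl (_ `|` _)); apply/seteqP; split=> x /=; rewrite E. Qed.

Lemma clo_catC K s t : clo K (s ++ t) = clo K (t ++ s).
Proof. by apply: eq_clo => x; rewrite !mem_cat orbC. Qed.

Lemma acl_clo K s : acl (clo K s) = clo K s.
Proof. exact: acl_acl. Qed.

Lemma clo_nil K : clo K [::] = acl K.
Proof. by rewrite /clo set_nil setU0. Qed.

Lemma clo_cat K s t : clo (clo K s) t = clo K (s ++ t).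
Proof.
rewrite {1}/clo /clo acl_setUl -setUA; congr (acl (_ `|` _)).
by apply/seteqP; split=> x /=; rewrite mem_cat => /orP.
Qed.

Lemma indep_cat K s t : indep K s -> indep (clo K s) t -> indep K (t ++ s).
Proof.
move=> Is; elim: t => //= x t IH [nx It]; split; last exact: IH.
move: nx; rewrite acl_setUl -setUA; apply: contra_not; apply: aclS.
by apply: setUS => y /=; rewrite mem_cat => /orP[]; [right|left].
Qed.

(** If the head [y] of the spanning list is dispensable it is dropped. Otherwise some [x] of [s]
    needs [y]; by exchange [x] can replace [y], and moving [x] into the base shortens both lists. *)
Lemma steinitz K s t : indep K s -> [set` s] `<=` clo K t -> (size s <= size t)%N.
Proof.
have [m] := ubnP (size s); elim: m => // m IHm in K s t *; rewrite ltnS => sm.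
elim: t K s sm => [|y t IHt] K s sm Is st.
  case: s Is st {sm} => // x s [nx Is] st; case: nx.
  apply: aclS (st x _) => [z []//|/=]; last by rewrite inE eqxx.
  by left.
have [/IHt|] := pselect ([set` s] `<=` clo K t).
  by move=> /(_ sm Is)/leq_trans; apply; exact: leqnSn.
move=> /existsNP[x] /not_implyP[/= xs nx].
case/splitPr: xs st sm Is => s1 s2 st sm Is.
(* Exchange is needed only for the entries after [x], whose independence did not take [x] into
   account. *)
have I12 : indep (x |` K) (s1 ++ s2).
  elim: s1 Is {st sm} => [|z s1 IH] /=.
    elim: s2 => //= z s2 IH [nx12 [nz I2]]; split; last first.
      apply: IH; split=> //; apply: contra_not nx12; apply: aclS; apply: setUS.
      by move=> w /= ws; rewrite inE ws orbT.
    move=> H; apply: nx12; rewrite -setUA in H; apply: aclS (acl_exchange H nz).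
    by move=> w [->|[Kw|ws]]; [right; rewrite /= inE eqxx|left|right; rewrite /= inE ws orbT].
  move=> [nz I]; split; last exact: IH.
  apply: contra_not nz; apply: aclS => w [[->|Kw]|] /=.
  - by right; rewrite mem_cat inE eqxx orbT.
  - by left.
  - by rewrite mem_cat => /orP[] ws; right; rewrite mem_cat ?inE ws ?orbT.
have : (size (s1 ++ s2) <= size t)%N.
  apply: (IHm (x |` K)) => //; first by move: sm; rewrite !size_cat /= addnS.
  have xE : clo (x |` K) t = clo K (y :: t).
    have Hy : acl (x |` clo K t) y.
      apply: acl_exchange; last by move: nx; rewrite acl_clo.
      by rewrite -clo_cons; apply: st => /=; rewrite mem_cat inE eqxx orbT.
    rewrite clo_cons; rewrite acl_setUr setUA -/(clo _ _) in Hy.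
    apply/seteqP; split.
      apply: clo_sub; first exact: acl_acl.
        move=> w [->|Kw]; last by apply: sub_acl; right; apply: sub_clo.
        by rewrite -clo_cons; apply: st => /=; rewrite mem_cat inE eqxx orbT.
      by move=> w wt; apply: sub_acl; right; apply: mem_clo.
    apply: acl_sub => w [->//|]; apply: aclS; apply: setSU => z; by right.
  rewrite xE; apply: subset_trans st => w /=; rewrite !mem_cat inE.
  by move=> /orP[]->; rewrite ?orbT.
by rewrite !size_cat /= addnS ltnS.
Qed.

Lemma basis_exists K t : exists s, [/\ indep K s, clo K s = clo K t & {subset s <= t}].
Proof.
elim: t => [|x t [s [Is E st]]]; first by exists [::].
have sub y : y \in s -> y \in x :: t by move=> /st; rewrite inE orbC => ->.
have [xs|nx] := pselect (clo K s x).
  exists s; split => //; rewrite clo_cons -E; apply/seteqP; split.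
    by apply: subset_trans (@sub_acl _ _) => y; right.
  by rewrite -[X in _ `<=` X]acl_clo; apply: aclS => y [->|].
exists (x :: s); split; first by [].
  by rewrite !clo_cons E.
by move=> y; rewrite inE => /orP[/eqP->|/sub//]; rewrite inE eqxx.
Qed.

End AlgebraicClosure.

(** * Extending isomorphisms between subrings of F to automorphisms *)

Section PartialIsomorphisms.
Variable F : closedFieldType.
Implicit Types (R : set (F * F)) (a b c d : F) (p q u v : {poly F}).

(* The graph of an isomorphism between two subrings of F. *)
Record piso R : Prop := Piso {
  piso1 : R (1, 1);
  pisoB : forall a b c d, R (a, b) -> R (c, d) -> R (a - c, b - d);
  pisoM : forall a b c d, R (a, b) -> R (c, d) -> R (a * c, b * d);
  piso_eq0 : forall a b, R (a, b) -> a = 0 <-> b = 0 }.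

Definition flip R : set (F * F) := [set ab | R (ab.2, ab.1)].
Definition dom R : set F := [set a | exists b, R (a, b)].

Lemma flipK : involutive flip.
Proof. by move=> R; apply/seteqP; split=> -[]. Qed.

Lemma piso_flip R : piso R -> piso (flip R).
Proof.
case=> R1 RB RM R0; split=> //; rewrite /flip /=.
- by move=> *; exact: RB.
- by move=> *; exact: RM.
- by move=> a b /R0 ->.
Qed.

Lemma piso0 R : piso R -> R (0, 0).
Proof. by case=> R1 RB _ _; have := RB _ _ _ _ R1 R1; rewrite !subrr. Qed.

Lemma pisoD R a b c d : piso R -> R (a, b) -> R (c, d) -> R (a + c, b + d).
Proof.
move=> HR Rab Rcd; rewrite -[c]opprK -[d]opprK -[- c]sub0r -[- d]sub0r.
by apply: (pisoB HR) => //; apply: (pisoB HR) => //; exact: piso0.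
Qed.

Lemma piso_sum R (I : Type) (r : seq I) (f g : I -> F) :
  piso R -> (forall i, R (f i, g i)) -> R (\sum_(i <- r) f i, \sum_(i <- r) g i).
Proof.
move=> HR H; elim: r => [|i r IH]; first by rewrite !big_nil; exact: piso0.
by rewrite !big_cons; exact: pisoD.
Qed.

Lemma piso_inj R a b c : piso R -> R (a, b) -> R (a, c) -> b = c.
Proof.
move=> HR Rab Rac; apply/eqP; rewrite -subr_eq0; apply/eqP.
by apply/(piso_eq0 HR (pisoB HR Rab Rac)); rewrite subrr.
Qed.

Lemma subring_dom R : piso R -> subring_set (dom R).
Proof.
move=> HR; split; first by exists 1; exact: piso1.
- by move=> a c [b Rab] [d Rcd]; exists (b - d); exact: pisoB.
- by move=> a c [b Rab] [d Rcd]; exists (b * d); exact: pisoM.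
Qed.

Definition frac_rel R : set (F * F) := [set x | exists a b c d,
  [/\ R (a, b), R (c, d), c != 0 & x = (a / c, b / d)]].

Lemma sub_frac_rel R : piso R -> R `<=` frac_rel R.
Proof.
move=> HR [a b] Rab; exists a, b, 1, 1; rewrite oner_eq0 !divr1.
by split=> //; exact: piso1.
Qed.

Lemma piso_frac_rel R : piso R -> piso (frac_rel R).
Proof.
move=> HR.
have N0 c d : R (c, d) -> c != 0 -> d != 0.
  by move=> Rcd; apply: contraNneq => /(piso_eq0 HR Rcd) ->.
split.
- by apply: sub_frac_rel => //; exact: piso1.
- move=> ? ? ? ? [a [b [c [d [Rab Rcd c0 [-> ->]]]]]].
  move=> [a' [b' [c' [d' [Rab' Rcd' c'0 [-> ->]]]]]].
  exists (a * c' - a' * c), (b * d' - b' * d), (c * c'), (d * d').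
  rewrite mulf_neq0//; split=> //; [|exact: pisoM|].
    by apply: (pisoB HR); exact: (pisoM HR).
  by congr (_, _); field; rewrite ?c0 ?c'0 ?(N0 _ _ Rcd) ?(N0 _ _ Rcd').
- move=> ? ? ? ? [a [b [c [d [Rab Rcd c0 [-> ->]]]]]].
  move=> [a' [b' [c' [d' [Rab' Rcd' c'0 [-> ->]]]]]].
  exists (a * a'), (b * b'), (c * c'), (d * d').
  rewrite mulf_neq0//; split=> //; [exact: pisoM|exact: pisoM|].
  by rewrite !mulf_div.
- move=> _ _ [a [b [c [d [Rab Rcd c0 [-> ->]]]]]].
  have d0 := N0 _ _ Rcd c0.
  split=> /eqP; rewrite mulf_eq0 invr_eq0 ?(negPf c0) ?(negPf d0) orbF => /eqP.
    by move=> /(piso_eq0 HR Rab) ->; rewrite mul0r.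
  by move=> /(piso_eq0 HR Rab) ->; rewrite mul0r.
Qed.

Lemma piso_bigcup (C : set (set (F * F))) : C !=set0 -> C `<=` piso ->
  total_on C subset -> piso (\bigcup_(R in C) R).
Proof.
move=> [R0 CR0] Cp Ct.
have join x y : (\bigcup_(R in C) R) x -> (\bigcup_(R in C) R) y ->
    exists R, [/\ C R, R x & R y].
  move=> [R CR Rx] [R' CR' Ry].
  by have [s|s] := Ct _ _ CR CR'; [exists R'|exists R]; split => //; exact: s.
split.
- by exists R0 => //; apply: piso1; exact: Cp.
- move=> a b c d Hx /(join _ _ Hx)[R [CR Rx Ry]].
  by exists R => //; apply: pisoB => //; exact: Cp.
- move=> a b c d Hx /(join _ _ Hx)[R [CR Rx Ry]].
  by exists R => //; apply: pisoM => //; exact: Cp.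
- by move=> a b [R CR Rx]; exact: piso_eq0 (Cp _ CR) _ _ Rx.
Qed.

Lemma piso_maximal R0 : piso R0 -> exists R, [/\ piso R, R0 `<=` R &
  forall R', piso R' -> R `<=` R' -> R' `<=` R].
Proof.
move=> HR0.
(* Joining [R0] inside the predicate takes care of the empty chain, whose union is empty and no
   partial isomorphism. *)
have [C Ct|R [HR Rmax]] := @Zorn_bigcup _ [set R | piso (R `|` R0)].
  move=> tot; rewrite /=.
  have -> : \bigcup_(X in C) X `|` R0 =
      \bigcup_(X in [set X `|` R0 | X in C] `|` [set R0]) X.
    apply/seteqP; split=> x.
      move=> [[X CX Xx]|R0x]; last by exists R0 => //; right.
      by exists (X `|` R0); [left; exists X|left].
    by move=> [_ [[X CX <-] [Xx|]|->]]; [left; exists X|right|right].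
  apply: piso_bigcup.
  - by exists R0; right.
  - by move=> _ [[X CX <-]|->//]; exact: Ct.
  - move=> _ _ [[X CX <-]|->] [[Y CY <-]|->].
    + by have [s|s] := tot _ _ CX CY; [left|right]; exact: setSU.
    + by right=> x; right.
    + by left=> x; right.
    + by left.
exists (R `|` R0); split; [exact: HR|by move=> x; right|].
move=> R' HR' sub; apply: contrapT => nsub; apply: (Rmax R').
  split; first by apply: subset_trans sub => x; left.
  by move=> s; apply: nsub => x /s; left.
rewrite /= (_ : R' `|` R0 = R') //.
by apply/seteqP; split=> x; [case=> // R0x; apply: sub; right|left].
Qed.

Definition poly_rel R p q := forall i, R (p`_i, q`_i).

Section PolyRel.
Variables (R : set (F * F)) (HR : piso R).

Lemma poly_relM p q u v :
  poly_rel R p q -> poly_rel R u v -> poly_rel R (p * u) (q * v).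
Proof.
move=> Rp Ru i; rewrite !coefM; apply: piso_sum => // j.
exact: (pisoM HR (Rp _) (Ru _)).
Qed.

Lemma poly_relB p q u v :
  poly_rel R p q -> poly_rel R u v -> poly_rel R (p - u) (q - v).
Proof. by move=> Rp Ru i; rewrite !coefB; exact: (pisoB HR). Qed.

Lemma poly_relD p q u v :
  poly_rel R p q -> poly_rel R u v -> poly_rel R (p + u) (q + v).
Proof. by move=> Rp Ru i; rewrite !coefD; exact: (pisoD HR). Qed.

Lemma poly_relC a b : R (a, b) -> poly_rel R a%:P b%:P.
Proof. by move=> Rab [|i]; rewrite !coefC //=; exact: piso0. Qed.

Lemma poly_relXn n : poly_rel R 'X^n 'X^n.
Proof. by move=> i; rewrite coefXn; case: eqP => _; [exact: piso1|exact: piso0]. Qed.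

Lemma poly_rel_size p q : poly_rel R p q -> size p = size q.
Proof.
move=> Rp; apply/eqP; rewrite eqn_leq; apply/andP; split; apply/leq_sizeP => j hj.
  by apply/(piso_eq0 HR (Rp j)); rewrite nth_default.
by apply/(piso_eq0 HR (Rp j)); rewrite nth_default.
Qed.

Lemma poly_rel_eq0 p q : poly_rel R p q -> (p == 0) = (q == 0).
Proof. by move=> Rp; rewrite -!size_poly_eq0 (poly_rel_size Rp). Qed.

Definition adjoin_rel a b : set (F * F) := [set x | exists p q,
  poly_rel R p q /\ x = (p.[a], q.[b])].

Lemma piso_adjoin_rel a b :
  (forall p q, poly_rel R p q -> p.[a] = 0 <-> q.[b] = 0) ->
  [/\ piso (adjoin_rel a b), R `<=` adjoin_rel a b & adjoin_rel a b (a, b)].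
Proof.
move=> H; have RC : R `<=` adjoin_rel a b.
  by move=> [c d] Rcd; exists c%:P, d%:P; rewrite !hornerC; split=> //; exact: poly_relC.
split=> //.
- split; first by apply: RC; exact: piso1.
  + move=> _ _ _ _ [p [q [Rp [-> ->]]]] [u [v [Ru [-> ->]]]].
    by exists (p - u), (q - v); rewrite !hornerE; split=> //; exact: poly_relB.
  + move=> _ _ _ _ [p [q [Rp [-> ->]]]] [u [v [Ru [-> ->]]]].
    by exists (p * u), (q * v); rewrite !hornerE; split=> //; exact: poly_relM.
  + by move=> _ _ [p [q [Rp [-> ->]]]]; exact: H.
- by exists 'X, 'X; rewrite !hornerX; split=> //; exact: (@poly_relXn 1).
Qed.

Lemma poly_rel_lift p : (forall i, dom R p`_i) -> exists q, poly_rel R p q.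
Proof.
move=> /choice[g Hg]; exists (\poly_(i < size p) g i) => i; rewrite coef_poly.
by case: ltnP => // hi; rewrite nth_default //; exact: piso0.
Qed.

(** Euclidean division carried out in parallel on both sides; closure of [R] under inverses makes
    the quotients of leading coefficients correspond. *)
Lemma poly_rel_div p0 q0 p q :
  (forall a b, R (a, b) -> R (a^-1, b^-1)) ->
  poly_rel R p0 q0 -> p0 != 0 -> poly_rel R p q ->
  exists u v r s, [/\ poly_rel R u v, poly_rel R r s, p = u * p0 + r,
    q = v * q0 + s & (size r < size p0)%N].
Proof.
move=> RV R0 p00; have [m] := ubnP (size p); elim: m => // m IH in p q *.
rewrite ltnS => pm Rp; have [lt|le] := ltnP (size p) (size p0).
  exists 0, 0, p, q; rewrite !mul0r !add0r; split=> // i.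
  by rewrite !coef0; exact: piso0.
have q00 : q0 != 0 by rewrite -(poly_rel_eq0 R0).
have sq := poly_rel_size Rp; have sq0 := poly_rel_size R0.
pose n := (size p - size p0)%N.
pose u := (lead_coef p / lead_coef p0)%:P * 'X^n : {poly F}.
pose v := (lead_coef q / lead_coef q0)%:P * 'X^n : {poly F}.
have Ru : poly_rel R u v.
  apply: poly_relM; last exact: poly_relXn.
  apply: poly_relC; rewrite /lead_coef -sq -sq0; apply: (pisoM HR); first exact: Rp.
  by apply: RV; exact: R0.
have sp0 : (0 < size p0)%N by rewrite size_poly_gt0.
have lt : (size (p - u * p0)%R < m)%N.
  have sp : (0 < size p)%N by exact: leq_trans le.
  apply: leq_trans pm; rewrite -[size p]prednK // ltnS; apply/leq_sizeP => j hj.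
  rewrite coefB /u mulrAC coefMXn coefCM ltnNge (leq_trans _ hj) /=; last first.
    by rewrite /n; move: (size p) (size p0) sp sp0 le => x y; lia.
  have [jE|jn] := eqVneq j (size p).-1.
    have -> : (j - n = (size p0).-1)%N by rewrite jE /n; lia.
    by rewrite jE -!/(lead_coef _) divfK ?subrr // lead_coef_eq0.
  have jp : (size p <= j)%N by move: jn; rewrite /n; lia.
  rewrite nth_default // [p0`_ _]nth_default ?mulr0 ?subr0 //.
  by rewrite /n; move: (size p) (size p0) sp sp0 le jp => x y; lia.
have [u' [v' [r [s [Ru' Rr pE qE sr]]]]] := IH _ _ lt (poly_relB Rp (poly_relM Ru R0)).
exists (u + u'), (v + v'), r, s; split=> //; first exact: poly_relD.
  by rewrite mulrDl -addrA -pE addrC subrK.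
by rewrite mulrDl -addrA -qE addrC subrK.
Qed.

End PolyRel.

(** Minimality in size replaces the minimal polynomial of [a]; neither monicity nor irreducibility
    has to be stated. *)
Definition min_root R a p0 :=
  forall p q, poly_rel R p q -> p != 0 -> root p a -> (size p0 <= size p)%N.

(** The remainder of [p] by [p0] vanishes at [a], hence is zero by minimality; so is its
    counterpart, and [q0] divides [q]. *)
Lemma min_root_transfer R a b p0 q0 : piso R ->
  (forall a b, R (a, b) -> R (a^-1, b^-1)) ->
  poly_rel R p0 q0 -> p0 != 0 -> root p0 a -> root q0 b -> min_root R a p0 ->
  forall p q, poly_rel R p q -> p.[a] = 0 -> q.[b] = 0.
Proof.
move=> HR RV R0 p00 /rootP pa /rootP qb pmin p q Rp pa0.
have [u [v [r [s [Ru Rr pE qE sr]]]]] := poly_rel_div HR RV R0 p00 Rp.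
have r0 : r == 0.
  have [//|r0] := boolP (r == 0); have /(pmin _ _ Rr r0) : root r a.
    by apply/rootP; move: pa0; rewrite pE !hornerE pa mulr0 add0r.
  by rewrite leqNgt sr.
move: (r0); rewrite (poly_rel_eq0 HR Rr) => /eqP s0.
by rewrite qE s0 !hornerE qb mulr0.
Qed.

Lemma min_root_ex R a p : piso R -> (forall i, dom R p`_i) -> p != 0 -> root p a ->
  exists p0 q0, [/\ poly_rel R p0 q0, p0 != 0, root p0 a & min_root R a p0].
Proof.
move=> HR Dp p0 pa; have [m] := ubnP (size p); elim: m => // m IH in p Dp p0 pa *.
rewrite ltnS => pm; have [q Rp] := poly_rel_lift HR Dp.
have [H|] := pselect (min_root R a p); first by exists p, q.
move=> /existsNP[u] /existsNP[v] /not_implyP[Ru] /not_implyP[u0] /not_implyP[ua].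
move=> /negP; rewrite -ltnNge => lt; apply: (IH u) => //.
  by move=> i; exists v`_i.
exact: leq_trans pm.
Qed.

(** Irreducibility passes from [p0] to [q0]: a smaller minimal [q1] at [b] would divide [q0], and in
    the corresponding factorization of [p0] both factors are smaller than [p0], while one of them
    vanishes at [a]. *)
Lemma min_root_flip R a b p0 q0 : piso R ->
  (forall a b, R (a, b) -> R (a^-1, b^-1)) ->
  poly_rel R p0 q0 -> p0 != 0 -> root p0 a -> root q0 b -> min_root R a p0 ->
  min_root (flip R) b q0.
Proof.
move=> HR RV R0 p00 pa qb pmin q p Rq q_0 qb0; rewrite leqNgt; apply/negP => lt.
have HR' := piso_flip HR.
have Dq i : dom (flip R) q`_i by exists p`_i; exact: Rq.
have [q1 [p1 [R1 q10 q1b q1min]]] := min_root_ex HR' Dq q_0 qb0.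
have s1 : (size q1 < size q0)%N by apply: leq_ltn_trans lt; exact: q1min Rq q_0 qb0.
have RV' c d : flip R (c, d) -> flip R (c^-1, d^-1) by exact: RV.
have [u [v [r [s [Ru Rr qE pE sr]]]]] := poly_rel_div HR' RV' R1 q10 R0.
have r0 : r == 0.
  have [//|r0] := boolP (r == 0); have /(q1min _ _ Rr r0) : root r b.
    apply/rootP; move: qb => /rootP; rewrite qE !hornerE (rootP q1b).
    by rewrite mulr0 add0r.
  by rewrite leqNgt sr.
have /eqP s0 : s == 0 by rewrite -(poly_rel_eq0 HR' Rr).
have sz1 := poly_rel_size HR' R1; have szu := poly_rel_size HR' Ru.
have sz0 := poly_rel_size HR R0.
have p1a : ~~ root p1 a.
  apply/negP => /(pmin p1 q1 R1); rewrite -(poly_rel_eq0 HR' R1) => /(_ q10).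
  by rewrite leqNgt -sz1 sz0 s1.
rewrite s0 addr0 in pE; move: (pa); rewrite pE rootM (negPf p1a) orbF => va.
have v0 : v != 0 by apply: contraNneq p00 => v0; rewrite pE v0 mul0r.
have p10 : p1 != 0 by rewrite -(poly_rel_eq0 HR' R1).
have := pmin v u Ru v0 va; rewrite pE size_mul // -sz1.
have : (1 < size q1)%N by exact: root_size_gt1 q1b.
by move: (size q1) (size v) => x y; lia.
Qed.

(** Maximality first makes [R] closed under inverses, since passing to fractions gains nothing. An
    algebraic [a] can then be sent to any root of the counterpart of its minimal polynomial. *)
Lemma piso_maximal_dom R : piso R ->
  (forall R', piso R' -> R `<=` R' -> R' `<=` R) -> acl (dom R) `<=` dom R.
Proof.
move=> HR Rmax a /(acl_subring (subring_dom HR))[p [Dp p_0 pa]].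
have RV c d : R (c, d) -> R (c^-1, d^-1).
  move=> Rcd; apply: (Rmax _ (piso_frac_rel HR)); first exact: sub_frac_rel.
  have [c0|c0] := eqVneq c 0.
    have d0 : d = 0 by apply/(piso_eq0 HR Rcd).
    by rewrite c0 d0 invr0; apply: sub_frac_rel => //; exact: piso0.
  by exists 1, 1, c, d; rewrite !mul1r; split=> //; exact: piso1.
have [p0 [q0 [R0 p00 p0a pmin]]] := min_root_ex HR Dp p_0 pa.
have /closed_rootP[b q0b] : size q0 != 1%N.
  by rewrite -(poly_rel_size HR R0) gtn_eqF // (root_size_gt1 p00 p0a).
have q00 : q0 != 0 by rewrite -(poly_rel_eq0 HR R0).
have [HR' RR' R'ab] : [/\ piso (adjoin_rel R a b), R `<=` adjoin_rel R a b &
    adjoin_rel R a b (a, b)].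
  apply: piso_adjoin_rel => // u v Ru; split.
    exact: min_root_transfer pmin _ _ Ru.
  have pmin' := min_root_flip HR RV R0 p00 p0a q0b pmin.
  apply: (min_root_transfer (piso_flip HR) _ _ q00 q0b p0a pmin') => //.
  by move=> c d; exact: RV.
by exists b; exact: Rmax R'ab.
Qed.

(** Maximality is symmetric under [flip], so a maximal extension is total on both sides; totality of
    its flip is surjectivity. *)
Lemma piso_extend (k : set F) R0 : piso R0 -> (forall a, k a -> R0 (a, a)) ->
  acl (dom R0) = setT -> acl (dom (flip R0)) = setT ->
  exists s : fieldAut k, forall a b, R0 (a, b) -> s a = b.
Proof.
move=> HR0 R0k D0 D0'; have [R [HR R0R Rmax]] := piso_maximal HR0.
have DR a : dom R a.
  apply: piso_maximal_dom => //; suff : acl (dom R0) a.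
    by apply: aclS => c [d /R0R Rcd]; exists d.
  by rewrite D0.
have DR' a : dom (flip R) a.
  apply: piso_maximal_dom; first exact: piso_flip.
    move=> R' HR' RR' -[c d] R'cd.
    by apply: (Rmax (flip R') (piso_flip HR') _ (d, c) R'cd) => -[x y] /= /(RR' (y, x)).
  suff : acl (dom (flip R0)) a.
    by apply: aclS => c [d /R0R Rcd]; exists d.
  by rewrite D0'.
move: DR => /choice[f Rf]; move: DR' => /choice[g Rg].
have fE a b : R (a, b) -> f a = b by move=> Rab; exact: piso_inj (Rf a) Rab.
have [fB fM fb fk] : [/\ zmod_morphism f, monoid_morphism f, bijective f &
    {in k, f =1 id}].
  split.
  - by move=> a b; apply: fE; exact: (pisoB HR).
  - by split=> [|a b]; apply: fE; [exact: piso1|exact: (pisoM HR)].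
  - exists g => a; last exact: fE (Rg a).
    by apply: (@piso_inj (flip R) (f a)); [exact: piso_flip|exact: Rg|exact: Rf].
  - by move=> a /set_mem ka; apply: fE; apply: R0R; exact: R0k.
have P : [/\ zmod_morphism f, monoid_morphism f, bijective f & {in k, f =1 id}] by [].
by exists (FieldAut P) => a b /R0R; exact: fE.
Qed.

End PartialIsomorphisms.

(** * Back-and-forth and homogeneity of F *)

Section BackAndForth.
Variable F : closedFieldType.
Implicit Types (R : set (F * F)) (K S : set F) (a b : F) (s t : seq F) (p q : {poly F}).

Lemma flip_adjoin_rel R a b : flip (adjoin_rel R a b) = adjoin_rel (flip R) b a.
Proof.
apply/seteqP; split=> -[x y] [p [q [Rp [-> ->]]]]; by exists q, p; split.
Qed.

Lemma acl_dom_adjoin_rel R a b : piso R -> adjoin_rel R a b (a, b) ->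
  R `<=` adjoin_rel R a b -> acl (dom (adjoin_rel R a b)) = acl (a |` dom R).
Proof.
move=> HR Rab RR; apply/seteqP; split; last first.
  by apply: aclS => x [->|[y Rxy]]; [exists b|exists y; exact: RR].
apply: acl_sub => x [_ [p [q [Rp [-> _]]]]].
have HA := subfield_acl (a |` dom R).
rewrite horner_coef; apply: (subfield_sum HA) => i; apply: (subfieldM HA).
  by apply: sub_acl; right; exists q`_i.
by apply: (subfieldX HA); apply: sub_acl; left.
Qed.

Lemma transcendental_root R a p : (forall i, dom R p`_i) -> ~ acl (dom R) a ->
  p.[a] = 0 -> p = 0.
Proof.
move=> Dp na pa; apply: contrapT => /eqP p0; apply: na; exists p; split=> //.
  by move=> i; exact: (@sub_gen_smallest _ (@subfield F)).
exact/rootP.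
Qed.

Lemma piso_adjoin_transcendental R a b : piso R ->
  ~ acl (dom R) a -> ~ acl (dom (flip R)) b ->
  [/\ piso (adjoin_rel R a b), R `<=` adjoin_rel R a b & adjoin_rel R a b (a, b)].
Proof.
move=> HR na nb; apply: piso_adjoin_rel => // p q Rp; split=> [pa|qb].
  have p0 : p == 0.
    by apply/eqP; apply: transcendental_root na pa => i; exists q`_i.
  by move: p0; rewrite (poly_rel_eq0 HR Rp) => /eqP->; rewrite horner0.
have q0 : q == 0.
  by apply/eqP; apply: transcendental_root nb qb => i; exists p`_i; exact: Rp.
by move: q0; rewrite -(poly_rel_eq0 HR Rp) => /eqP->; rewrite horner0.
Qed.

(** [R] is not asked to fix [K] or to send [s] to [t]; equal finite dimensions of the two sides over
    [K] are what allows a further step. *)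
Record matched K R s t : Prop := Matched {
  matched_piso : piso R;
  matched_size : size s = size t;
  matched_indep : indep K s;
  matched_indep_flip : indep K t;
  matched_dom : acl (dom R) = clo K s;
  matched_flip : acl (dom (flip R)) = clo K t }.

Lemma matchedC K R s t : matched K R s t -> matched K (flip R) t s.
Proof. by case=> *; split; rewrite ?flipK //; exact: piso_flip. Qed.

Lemma matched_adjoin K R s t a b : matched K R s t -> ~ clo K s a -> ~ clo K t b ->
  [/\ matched K (adjoin_rel R a b) (a :: s) (b :: t), R `<=` adjoin_rel R a b &
    adjoin_rel R a b (a, b)].
Proof.
move=> [HR st Is It Ds Dt] na nb.
have [HR' RR' Rab] : [/\ piso (adjoin_rel R a b), R `<=` adjoin_rel R a b &
    adjoin_rel R a b (a, b)].
  by apply: piso_adjoin_transcendental; rewrite ?Ds ?Dt.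
split=> //; split=> //=; first by rewrite st.
  by rewrite acl_dom_adjoin_rel // clo_cons -Ds acl_setUr.
rewrite flip_adjoin_rel acl_dom_adjoin_rel ?clo_cons -?Dt ?acl_setUr //.
- exact: piso_flip.
- by rewrite -flip_adjoin_rel.
- by rewrite -flip_adjoin_rel => -[x y]; exact: RR'.
Qed.

(** A partner for a transcendental [a] exists: if [t] spanned F, the longer independent list
    [a :: s] would contradict [steinitz]. *)
Lemma matched_forth K R s t a : matched K R s t ->
  exists R' s' t', [/\ matched K R' s' t', R `<=` R' & acl (dom R') a].
Proof.
move=> HR; have [Da|na] := pselect (clo K s a).
  by exists R, s, t; split=> //; rewrite (matched_dom HR).
have [b nb] : exists b, ~ clo K t b.
  apply/not_existsP => H.
  have : (size (a :: s) <= size t)%N.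
    apply: (@steinitz _ K); first by split => //; exact: matched_indep HR.
    by move=> x _; apply: contrapT => /H.
  by rewrite /= (matched_size HR) ltnn.
have [HR' RR' Rab] := matched_adjoin HR na nb.
by exists (adjoin_rel R a b), (a :: s), (b :: t); split=> //; apply: sub_acl; exists b.
Qed.

Lemma matched_back_forth K R s t a : matched K R s t ->
  exists R' s' t', [/\ matched K R' s' t', R `<=` R', acl (dom R') a &
    acl (dom (flip R')) a].
Proof.
move=> /(@matched_forth _ _ _ _ a)[R1 [s1 [t1 [/matchedC HR1 RR1 D1]]]].
have [R2 [t2 [s2 [/matchedC HR2 RR2 D2]]]] := matched_forth a HR1.
have RR3 : R1 `<=` flip R2 by move=> [x y] ?; exact: RR2.
exists (flip R2), s2, t2; rewrite flipK; split=> //.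
  exact: subset_trans RR3.
by apply: aclS D1 => x [y R1xy]; exists y; exact: RR3.
Qed.

(** The chain only has to reach the generators [b n], on both sides; [piso_extend] takes care of
    everything algebraic over them. *)
Lemma matched_extend (k K : set F) R s t (b : nat -> F) :
  acl (K `|` range b) = setT -> matched K R s t -> (forall a, k a -> R (a, a)) ->
  exists g : fieldAut k, forall x y, R (x, y) -> g x = y.
Proof.
move=> Kb HR Rk.
(* Bundling a relation with its two lists lets one choice function iterate the step. *)
pose T := {x : set (F * F) * seq F * seq F | matched K x.1.1 x.1.2 x.2}.
pose rel (x : T) := (sval x).1.1.
have /choice[next Hnext] : forall nx : nat * T, exists y : T,
    [/\ rel nx.2 `<=` rel y, acl (dom (rel y)) (b nx.1) &
        acl (dom (flip (rel y))) (b nx.1)].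
  move=> [n [[[R1 s1] t1] /= H1]].
  have [R2 [s2 [t2 [H2 ? ? ?]]]] := matched_back_forth (b n) H1.
  by exists (exist _ (R2, s2, t2) H2).
pose x0 : T := exist _ (R, s, t) HR.
pose f := fix f n := if n is m.+1 then next (m, f m) else x0.
have fS n : rel (f n) `<=` rel (f n.+1) by have [] := Hnext (n, f n).
have fM m n : (m <= n)%N -> rel (f m) `<=` rel (f n).
  elim: n => [|n IH]; first by rewrite leqn0 => /eqP ->.
  rewrite leq_eqVlt => /orP[/eqP->//|/IH]; move/subset_trans; apply; exact: fS.
pose R' := \bigcup_(X in range (rel \o f)) X.
have HR' : piso R'.
  apply: piso_bigcup.
  - by exists R; exists 0.
  - by move=> _ [n _ <-]; exact: matched_piso (svalP (f n)).
  - move=> _ _ [m _ <-] [n _ <-].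
    by have [/fM|/ltnW/fM] := leqP m n; [left|right].
have RR' : R `<=` R' by move=> x Rx; exists R => //; exists 0.
have sub n : rel (f n) `<=` R' by move=> x Rx; exists (rel (f n)) => //; exists n.
have [g Hg] : exists g : fieldAut k, forall x y, R' (x, y) -> g x = y.
  apply: piso_extend => //; first by move=> a /Rk; exact: RR'.
  - apply/seteqP; split=> // a _; have : acl (K `|` range b) a by rewrite Kb.
    apply: acl_sub => x [Kx|[n _ <-]].
      have : clo K s x by exact: sub_clo.
      by rewrite -(matched_dom HR); apply: aclS => y [z /RR']; exists z.
    have [_ D _] := Hnext (n, f n).
    by apply: aclS D => y [z /(sub n.+1)]; exists z.
  - apply/seteqP; split=> // a _; have : acl (K `|` range b) a by rewrite Kb.
    apply: acl_sub => x [Kx|[n _ <-]].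
      have : clo K t x by exact: sub_clo.
      by rewrite -(matched_flip HR); apply: aclS => y [z /RR']; exists z.
    have [_ _ D] := Hnext (n, f n).
    by apply: aclS D => y [z /(sub n.+1)]; exists z.
by exists g => x y /RR'; exact: Hg.
Qed.

Lemma matched_id K : subfield K -> acl K = K ->
  matched K [set x | K x.1 /\ x.1 = x.2] [::] [::].
Proof.
move=> HK EK; set R := [set x | _].
have D : dom R = K.
  by apply/seteqP; split=> [x [y []]//|x Kx]; exists x.
have Rf : flip R = R.
  by apply/seteqP; split=> -[x y] [/= Kx xy]; split => //=; [rewrite -xy|rewrite -xy].
split=> //; rewrite ?Rf ?D ?clo_nil //; split.
- by split=> //; exact: subfield1.
- by move=> a b c d [/= Ka <-] [/= Kc <-]; split=> //; exact: subfieldB.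
- by move=> a b c d [/= Ka <-] [/= Kc <-]; split=> //; exact: subfieldM.
- by move=> a b [/= _ <-].
Qed.

(** The identity of [K] is extended entry by entry along [s] and [t], each entry being
    transcendental over the preceding stage, and then to all of F. *)
Lemma homogeneous (k K : set F) s t (b : nat -> F) :
  acl (K `|` range b) = setT -> subfield K -> acl K = K -> k `<=` K ->
  size s = size t -> indep K s -> indep K t ->
  exists2 g : fieldAut k, fixator k K g & map g s = t.
Proof.
move=> Kb HK EK kK st Is It.
have [R [HR RK Rst]] : exists R, [/\ matched K R s t, forall x, K x -> R (x, x) &
    forall i, (i < size s)%N -> R (nth 0 s i, nth 0 t i)].
  elim: s t st Is It => [|x s IH] [|y t] // st Is It.
    by exists [set x | K x.1 /\ x.1 = x.2]; split=> //; exact: matched_id.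
  case: st Is It => st [nx Is] [ny It].
  have [R [HR RK Rst]] := IH t st Is It.
  have [HR' RR' Rab] := matched_adjoin HR nx ny.
  exists (adjoin_rel R x y); split=> //; first by move=> z /RK/RR'.
  by case=> [|i] //= /Rst/RR'.
have [g Hg] := matched_extend Kb HR (fun a ka => RK a (kK a ka)).
exists g; first by move=> x /RK/Hg.
apply: (@eq_from_nth _ 0); rewrite size_map // => i hi.
by rewrite (nth_map 0) //; apply: Hg; exact: Rst.
Qed.

End BackAndForth.

(** * Linear disjointness and gluing of isomorphisms *)

Section LinearDisjointness.
Variables (F : closedFieldType) (k : set F).
Implicit Types (K L M N : set F) (g : fieldAut k).

(** Stated for subsets of a fixed finite type, so that inductions can delete indices without
    reindexing the families. *)
Definition lin_disjoint K N M : Prop :=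
  forall (I : finType) (A : {set I}) (x m : I -> F),
    (forall i, N (x i)) -> (forall i, M (m i)) ->
    \sum_(i in A) m i * x i = 0 -> (exists2 i, i \in A & m i != 0) ->
    exists c : I -> F, [/\ forall i, i \in A -> K (c i),
      exists2 i, i \in A & c i != 0 & \sum_(i in A) c i * x i = 0].

(* Artin's argument: a relation of minimal support, normalized to have a
   coefficient 1, is invariant under the automorphisms fixing N. *)
Lemma fixed_lin_disjoint K N M : subfield M ->
  (forall m, M m -> ~ K m ->
    exists g, [/\ fixator k N g, forall z, M z -> M (g z) & g m <> m]) ->
  lin_disjoint K N M.
Proof.
move=> HM HK I A x m Nx; have [r] := ubnP #|[set i in A | m i != 0]|.
elim: r => // r IH in m *; rewrite ltnS => cr Mm rel0 [i0 Ai0 m0].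
pose c i := m i / m i0.
have Mc i : M (c i) by exact: subfield_div.
have crel : \sum_(i in A) c i * x i = 0.
  transitivity ((\sum_(i in A) m i * x i) / m i0); last by rewrite rel0 mul0r.
  by rewrite mulr_suml; apply: eq_bigr => i _; rewrite mulrAC.
have [H|] := pselect (forall i, i \in A -> K (c i)).
  by exists c; split=> //; exists i0 => //; rewrite /c divff ?oner_eq0.
move=> /existsNP[i1 /not_implyP[Ai1 /(HK _ (Mc i1))[g [gN gM gc]]]].
apply: (IH (fun i => c i - g (c i))).
- apply: leq_trans cr; apply: proper_card; apply/properP; split.
    apply/fintype.subsetP => i; rewrite !inE => /andP[-> /=]; apply: contraNneq => mi.
    by rewrite /c mi mul0r rmorph0 subrr.
  exists i0; rewrite !inE ?Ai0 //= negbK /c divff // rmorph1 subrr //.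
- by move=> i; apply: subfieldB => //; exact: gM.
- transitivity ((\sum_(i in A) c i * x i) - g (\sum_(i in A) c i * x i)); last first.
    by rewrite crel rmorph0 subrr.
  rewrite rmorph_sum -sumrB; apply: eq_bigr => i _; rewrite mulrBl (rmorphM g (c i) (x i)).
  by congr (_ - _ * _); apply/esym; exact: gN.
- by exists i1 => //; rewrite subr_eq0 eq_sym; exact/eqP.
Qed.

(** Linear disjointness gives a relation over [K], normalized to have coefficient 1 at [i0], which
    eliminates [x i0]. Since [f] fixes its coefficients, the elimination commutes with [f]. *)
Lemma glue_eq0 K N M (f : {rmorphism F -> F}) (I : finType) (A : {set I}) (x m : I -> F) :
  subfield M -> K `<=` M -> lin_disjoint K N M -> (forall z, K z -> f z = z) ->
  (forall i, N (x i)) -> (forall i, M (m i)) ->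
  \sum_(i in A) m i * x i = 0 -> \sum_(i in A) f (m i) * x i = 0.
Proof.
move=> HM KM LD fK Nx; have [r] := ubnP #|A|.
elim: r => // r IH in A m *; rewrite ltnS => Ar Mm rel0.
have [[i Ai mi]|] := pselect (exists2 i, i \in A & m i != 0); last first.
  move=> H; rewrite big1 // => i Ai; have [->|mi] := eqVneq (m i) 0.
    by rewrite rmorph0 mul0r.
  by case: H; exists i.
have [c [Kc [i0 Ai0 c0] crel]] := LD I A x m Nx Mm rel0 (ex_intro2 _ _ i Ai mi).
pose d i := if i \in A then c i / c i0 else 0.
have Kd j : j \in A -> f (d j) = d j.
  by move=> Aj; rewrite /d Aj fmorph_div !fK //; exact: Kc.
have Md j : M (d j).
  rewrite /d; case: ifP => Aj; last exact: subfield0.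
  by apply: subfield_div => //; apply: KM; exact: Kc.
have drel : \sum_(j in A) d j * x j = 0.
  transitivity ((\sum_(j in A) c j * x j) / c i0); last by rewrite crel mul0r.
  by rewrite mulr_suml; apply: eq_bigr => j Aj; rewrite /d Aj mulrAC.
have di0 : d i0 = 1 by rewrite /d Ai0 divff.
(* Needed twice: for [f], and for the identity to see that the shortened relation still holds. *)
have red (h : {rmorphism F -> F}) : (forall j, j \in A -> h (d j) = d j) ->
    \sum_(j in A) h (m j) * x j = \sum_(j in A :\ i0) h (m j - m i0 * d j) * x j.
  move=> hd; transitivity (\sum_(j in A) h (m j - m i0 * d j) * x j).
    transitivity (\sum_(j in A) h (m j) * x j - h (m i0) * \sum_(j in A) d j * x j).
      by rewrite drel mulr0 subr0.
    rewrite mulr_sumr -sumrB.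
    by apply: eq_bigr => j Aj; rewrite rmorphB rmorphM hd // mulrBl mulrA.
  rewrite (big_setD1 i0) //= di0 mulr1 subrr rmorph0 mul0r add0r.
  exact: eq_bigr.
rewrite red //; apply: IH.
- by apply: leq_trans Ar; rewrite (cardsD1 i0 A) Ai0.
- by move=> j; apply: subfieldB => //; exact: subfieldM.
- by have := red idfun (fun _ _ => erefl); rewrite /= rel0.
Qed.

(** The would-be map on the ring generated by [N] and [M] that is the identity on [N] and [f] on
    [M]. *)
Definition glue_rel N M (f : F -> F) : set (F * F) := [set z |
  exists (I : finType) (x m : I -> F), [/\ forall i, N (x i), forall i, M (m i) &
    z = (\sum_i m i * x i, \sum_i f (m i) * x i)]].

(** That the map is well defined is [glue_eq0] for [g]; that it is injective is [glue_eq0] for the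
    inverse of [g], whence the disjointness hypothesis on the image of [M]. *)
Lemma piso_glue_rel K N M g : subfield N -> subfield M ->
  K `<=` M -> lin_disjoint K N M -> lin_disjoint K N (g @` M) ->
  fixator k K g -> piso (glue_rel N M g).
Proof.
move=> HN HM KM LD LDg gK; split.
- exists unit, (fun=> 1), (fun=> 1); split=> [_|_|]; try exact: subfield1.
  by rewrite !big_const /= !card_unit /= rmorph1 !mulr1 !addr0.
- move=> _ _ _ _ [I [x [m [Nx Mm [-> ->]]]]] [J [y [n [Ny Mn [-> ->]]]]].
  exists (I + J)%type, (fun i => match i with inl i => x i | inr j => y j end),
    (fun i => match i with inl i => m i | inr j => - n j end).
  split=> [[]//|[i|j]//|]; first exact: subfieldN.
  rewrite !big_sumType /=; congr (_ + _, _ + _).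
    by rewrite -sumrN; apply: eq_bigr => j _; rewrite mulNr.
  by rewrite -sumrN; apply: eq_bigr => j _; rewrite rmorphN mulNr.
- move=> _ _ _ _ [I [x [m [Nx Mm [-> ->]]]]] [J [y [n [Ny Mn [-> ->]]]]].
  exists (I * J)%type, (fun i => x i.1 * y i.2), (fun i => m i.1 * n i.2).
  split=> [i|i|]; try exact: subfieldM.
  congr (_, _); rewrite big_distrlr pair_bigA /=; apply: eq_bigr => i _.
    by rewrite mulrACA.
  by rewrite rmorphM mulrACA.
- have E (I : finType) (h : I -> F) : \sum_i h i = \sum_(i in [set: I]%SET) h i.
    by apply: eq_bigl => i; rewrite inE.
  move=> _ _ [I [x [m [Nx Mm [-> ->]]]]]; rewrite !E; split.
    exact: (@glue_eq0 K N M g).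
  move=> H; pose g' := (g^-1)%g : fieldAut k.
  have gg' z : g' (g z) = z.
    by have : (g' * g)%g = 1%g by [rewrite mulVg]; move/(congr1 (fun h : fieldAut k => h z)).
  suff H' : \sum_(i in [set: I]%SET) g' (g (m i)) * x i = 0.
    by rewrite -[RHS]H'; apply: eq_bigr => i _; rewrite gg'.
  apply: (@glue_eq0 K N (g @` M) g' I [set: I]%SET x (g \o m)) => //.
  + split; first by apply/mem_set; exists 1; [exact: subfield1|rewrite rmorph1].
      move=> _ _ /set_mem[a Ma <-] /set_mem[b Mb <-]; apply/mem_set.
      by exists (a - b); [exact: subfieldB|rewrite rmorphB].
    move=> _ _ /set_mem[a Ma <-] /set_mem[b Mb <-]; apply/mem_set.
    by exists (a / b); [exact: subfield_div|rewrite fmorph_div].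
  + by move=> z Kz; exists z; [exact: KM|exact: gK].
  + by move=> z Kz; rewrite -[in LHS](gK z Kz); exact: gg'.
  + by move=> i; exists (m i).
Qed.

End LinearDisjointness.

(** * Action of automorphisms on closures and fixators *)

Section AutomorphismAction.
Variables (F : closedFieldType) (k : set F).
Implicit Types (g h : fieldAut k) (K A B S : set F) (s t : seq F).

Lemma fieldAutMP g h x : (g * h)%g x = g (h x).
Proof. by []. Qed.

Lemma fieldAutKV g x : g ((g^-1)%g x) = x.
Proof. by rewrite -fieldAutMP mulgV. Qed.

Lemma fieldAutK g x : (g^-1)%g (g x) = x.
Proof. by rewrite -fieldAutMP mulVg. Qed.

Lemma subgroup_fixator A : subgroup (fixator k A).
Proof.
apply/subgroupP; split=> // [g h Hg Hh x Ax|g Hg x Ax].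
  by rewrite fieldAutMP Hh // Hg.
by rewrite -{1}(Hg x Ax) fieldAutK.
Qed.

Lemma fixatorS A B : A `<=` B -> fixator k B `<=` fixator k A.
Proof. by move=> AB g Hg x /AB; exact: Hg. Qed.

Lemma fixator_image (H : set (fieldAut k)) g A : subgroup H -> H g ->
  fixator k A `<=` H -> fixator k (g @` A) `<=` H.
Proof.
move=> /subgroupP[H1 HM HV] Hg AH h Hh.
have -> : h = (g * (g^-1 * h * g) * g^-1)%g.
  by rewrite !mulgA mulgV mul1g -mulgA mulgV mulg1.
apply: (HM _ _ _ (HV _ Hg)); apply: (HM _ _ Hg); apply: AH => x Ax.
by rewrite !fieldAutMP Hh ?fieldAutK //; exists x.
Qed.

Lemma acl_image_sub g S : g @` acl S `<=` acl (g @` S).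
Proof.
move=> _ [x [p [Sp p0 px]] <-]; exists (map_poly g p).
split; rewrite ?map_poly_eq0 // ?fmorph_root //= => i.
rewrite coef_map /=; move: (p`_i) (Sp i) => {p p0 px Sp i}x Hx.
have HT := subfield_smallest (g @` S).
apply: (Hx (g @^-1` smallest (@subfield F) (g @` S))); split; last first.
  by move=> y Sy; apply: (@sub_gen_smallest _ (@subfield F)); exists y.
split; first by apply/mem_set; rewrite /= rmorph1; exact: (subfield1 HT).
  by move=> y z /set_mem ? /set_mem ?; apply/mem_set; rewrite /= rmorphB; exact: (subfieldB HT).
by move=> y z /set_mem ? /set_mem ?; apply/mem_set; rewrite /= fmorph_div; exact: (subfield_div HT).
Qed.

Lemma image_fieldAutK g S : (g^-1)%g @` (g @` S) = S.
Proof.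
apply/seteqP; split=> [_ [_ [x Sx <-] <-]|x Sx]; first by rewrite fieldAutK.
by exists (g x); [exists x|rewrite fieldAutK].
Qed.

Lemma image_fieldAutKV g S : g @` ((g^-1)%g @` S) = S.
Proof. by have := image_fieldAutK g^-1%g S; rewrite invgK. Qed.

Lemma acl_image g S : g @` acl S = acl (g @` S).
Proof.
apply/seteqP; split; first exact: acl_image_sub.
rewrite -[X in X `<=` _](image_fieldAutKV g); apply: image_subset.
by apply: subset_trans (@acl_image_sub _ _) _; rewrite image_fieldAutK.
Qed.

Lemma image_fixator K g : fixator k K g -> g @` K = K.
Proof.
move=> gK; apply/seteqP; split=> [_ [x Kx <-]|x Kx]; first by rewrite gK.
by exists x => //; rewrite gK.
Qed.

Lemma clo_image K s g : g @` clo K s = clo (g @` K) (map g s).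
Proof.
rewrite acl_image image_setU; congr (acl (_ `|` _)).
apply/seteqP; split=> [_ [x /= xs <-]|y /mapP[x xs ->]]; last by exists x.
by rewrite /= map_f.
Qed.

Lemma indep_image K s g : indep K s -> indep (g @` K) (map g s).
Proof.
elim: s => //= x s IH [nx Is]; split; last exact: IH.
rewrite -/(clo _ _) -clo_image => -[y Ky] /(can_inj (fieldAutK g)) yx.
by apply: nx; rewrite -yx.
Qed.

End AutomorphismAction.

(** * Dimension of closed fields over a base *)

Section Dimension.
Variable F : closedFieldType.
Implicit Types (K A B : set F) (s t : seq F) (d e : nat).

(** A form of finite transcendence degree with a list as basis, on which automorphisms act by [map];
    it also makes [A] algebraically closed. *)
Definition fdim K A d := exists s, [/\ indep K s, size s = d & A = clo K s].

Lemma fdim_acl K A d : fdim K A d -> acl A = A.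
Proof. by move=> [s [_ _ ->]]; exact: acl_clo. Qed.

Lemma fdim_sub K A d : fdim K A d -> K `<=` A.
Proof. by move=> [s [_ _ ->]]; exact: sub_clo. Qed.

Lemma fdim0 K : acl K = K -> fdim K K 0.
Proof. by exists [::]; rewrite clo_nil. Qed.

Lemma fdim_le K A B d e : fdim K A d -> fdim K B e -> A `<=` B -> (d <= e)%N.
Proof.
move=> [s [Is <- ->]] [t [_ <- ->]] AB; apply: (steinitz Is).
by apply: subset_trans AB; exact: mem_clo.
Qed.

Lemma fdim_inj K A d e : fdim K A d -> fdim K A e -> d = e.
Proof. by move=> Ad Ae; apply/eqP; rewrite eqn_leq (fdim_le Ad Ae) ?(fdim_le Ae Ad). Qed.

Lemma fdim_eq K A B d e : fdim K A d -> fdim K B e -> A `<=` B -> (e <= d)%N -> A = B.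
Proof.
move=> [s [Is <- AE]] [t [_ <- BE]] AB le; apply/seteqP; split=> // z Bz.
apply: contrapT => nz; have : (size (z :: s) <= size t)%N.
  apply: (@steinitz _ K); first by split=> //; rewrite -/(clo _ _) -AE.
  by move=> y; rewrite /= inE -BE => /orP[/eqP->//|ys]; apply: AB; rewrite AE; exact: mem_clo.
by rewrite leqNgt ltnS le.
Qed.

(** A basis of [A] over K(z) followed by [z] is one over [K]. This drop by exactly one drives the
    induction on dimension. *)
Lemma fdim_adjoin K A d z : fdim K A d -> A z -> ~ acl K z ->
  exists2 e, d = e.+1 & fdim (clo K [:: z]) A e.
Proof.
move=> [s [Is sd AE]] Az nz; have [t [It Et _]] := basis_exists (clo K [:: z]) s.
have Iz : indep K [:: z] by split=> //; rewrite -/(clo _ _) clo_nil.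
have ztE : clo K (t ++ [:: z]) = A.
  rewrite clo_catC -clo_cat Et clo_cat; apply/seteqP; split.
    apply: clo_sub; rewrite ?AE ?acl_clo //; first exact: sub_clo.
    by move=> x /=; rewrite inE -AE => /orP[/eqP->//|xs]; rewrite AE; exact: mem_clo.
  by rewrite AE; apply: aclS; apply: setUS => x /=; rewrite inE orbC => ->.
exists (size t); last first.
  by exists t; split=> //; rewrite clo_cat -ztE clo_catC.
apply: (@fdim_inj K A); first by exists s.
by exists (t ++ [:: z]); split=> //; [exact: indep_cat|rewrite size_cat addn1].
Qed.

Lemma fdim_extend K A z e : ~ acl K z -> fdim (clo K [:: z]) A e -> fdim K A e.+1.
Proof.
move=> nz [t [It te ->]]; exists (t ++ [:: z]); split.
- by apply: indep_cat => //; split=> //; rewrite -/(clo _ _) clo_nil.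
- by rewrite size_cat addn1 te.
- by rewrite clo_cat clo_catC.
Qed.

Lemma fdim_image (k : set F) K A d (g : fieldAut k) : fdim K A d ->
  fixator k K g -> fdim K (g @` A) d.
Proof.
move=> [s [Is sd ->]] gK; exists (map g s); split; rewrite ?size_map //.
  by rewrite -(image_fixator gK); exact: indep_image.
by rewrite clo_image (image_fixator gK).
Qed.

Lemma fdim_clo K t : exists d, fdim K (clo K t) d.
Proof. by have [s [Is E _]] := basis_exists K t; exists (size s), s. Qed.

(** As for groups: with [x] outside [A] and [y] outside [B], one of [x], [y], [x + y] avoids
    both. *)
Lemma proper_union A B : subfield A -> subfield B -> A <> setT -> B <> setT ->
  exists z, ~ A z /\ ~ B z.
Proof.
move=> HA HB /eqP/setTPn[x nx] /eqP/setTPn[y ny].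
have [Bx|] := pselect (B x); last by exists x.
have [Ay|] := pselect (A y); last by exists y.
exists (x + y); split=> H.
  by apply: nx; rewrite -[x](addrK y); exact: (subfieldB HA).
by apply: ny; rewrite -[y](addKr x) addrC; exact: (subfieldB HB).
Qed.

End Dimension.

(** * The smallest closed field whose fixator lies in H *)

Section SmallestField.
Variables (F : closedFieldType) (k : set F) (b : nat -> F).
Hypothesis kb : acl (k `|` range b) = setT.
Implicit Types (K A B X Y : set F) (s t : seq F) (d e : nat).

Lemma acl_subfield A : acl A = A -> subfield A.
Proof. by move=> <-; exact: subfield_acl. Qed.

Lemma homogeneous_seq K s t : acl K = K -> k `<=` K -> size s = size t ->
  indep K s -> indep K t -> exists2 g : fieldAut k, fixator k K g & map g s = t.
Proof.
move=> EK kK st Is It; apply: (@homogeneous _ _ _ _ _ b) => //; last exact: acl_subfield.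
by apply/seteqP; split=> // x _; have : setT x by []; rewrite -kb; apply: aclS; exact: setSU.
Qed.

Lemma homogeneous_point K x y : acl K = K -> k `<=` K -> ~ K x -> ~ K y ->
  exists2 g : fieldAut k, fixator k K g & g x = y.
Proof.
move=> EK kK nx ny.
have I1 z : ~ K z -> indep K [:: z] by split=> //; rewrite -/(clo _ _) clo_nil EK.
by have [//|g gK [gx]] := homogeneous_seq EK kK _ (I1 x nx) (I1 y ny); exists g.
Qed.

(** An [x] outside [K] could be moved to [x + 1], which is also outside [K]. *)
Lemma fixed_field K x : acl K = K -> k `<=` K ->
  (forall g, fixator k K g -> g x = x) -> K x.
Proof.
move=> EK kK fx; apply: contrapT => nx; have HK := acl_subfield EK.
have nx1 : ~ K (x + 1).
  by move=> H; apply: nx; rewrite -[x](addrK 1); apply: subfieldB => //; exact: subfield1.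
have [g /fx-> /eqP] := homogeneous_point EK kK nx nx1.
by rewrite -subr_eq0 opprD addNKr oppr_eq0 oner_eq0.
Qed.

(** The glued map on the compositum matches the independent pairs [[:: y; z]] and [[:: g y; z]], so
    back-and-forth extends it to F. *)
Lemma glue K Y z y (g : fieldAut k) : acl K = K -> k `<=` K ->
  ~ K z -> ~ K y ->
  lin_disjoint K (clo K [:: z]) (clo K [:: y]) ->
  lin_disjoint K (clo K [:: z]) (g @` clo K [:: y]) ->
  ~ clo K [:: y] z -> ~ clo K [:: g y] z -> fixator k K g ->
  exists2 h : fieldAut k, fixator k (clo K [:: z]) h &
    forall x, clo K [:: y] x -> h x = g x.
Proof.
move=> EK kK nz ny LD LDg zy zgy gK.
have [HN HM] : subfield (clo K [:: z]) /\ subfield (clo K [:: y]).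
  by split; exact: subfield_acl.
pose R := glue_rel (clo K [:: z]) (clo K [:: y]) g.
have HR : piso R by apply: piso_glue_rel LD LDg gK => //; exact: sub_clo.
have RN x : clo K [:: z] x -> R (x, x).
  move=> Nx; exists unit, (fun=> x), (fun=> 1).
  split=> // [_|]; first exact: subfield1.
  by rewrite !big_const /= !card_unit /= rmorph1 !mul1r !addr0.
have RM x : clo K [:: y] x -> R (x, g x).
  move=> Mx; exists unit, (fun=> 1), (fun=> x).
  split=> // [_|]; first exact: subfield1.
  by rewrite !big_const /= !card_unit /= !mulr1 !addr0.
have cloS u : clo K [:: z] `<=` clo K [:: u; z] /\ clo K [:: u] `<=` clo K [:: u; z].
  by split; apply: aclS; apply: setUS => x /=; rewrite !inE => /eqP->; rewrite eqxx ?orbT.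
have [h Hh] : exists h : fieldAut k, forall x w, R (x, w) -> h x = w.
  apply: (@matched_extend _ k K R [:: y; z] [:: g y; z] b).
  - by apply/seteqP; split=> // x _; have : setT x by []; rewrite -kb; apply: aclS; exact: setSU.
  - have I1 : indep K [:: z] by split=> //; rewrite -/(clo _ _) clo_nil EK.
    have sym u : ~ K u -> ~ clo K [:: u] z -> ~ clo K [:: z] u.
      move=> nu nuz H; apply: nuz; rewrite clo_cons clo_nil EK.
      by apply: acl_exchange; rewrite ?EK //; rewrite clo_cons clo_nil EK in H.
    have ngy : ~ K (g y).
      move=> Ky; apply: ny; rewrite -(fieldAutK g y).
      by have [_ _ KV] := (subgroupP _).1 (subgroup_fixator k K); rewrite (KV _ gK).
    have HU u : subfield (clo K [:: u; z]) by exact: subfield_acl.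
    split=> //.
    + by split=> //; exact: sym.
    + by split=> //; exact: sym.
    + apply/seteqP; split; last first.
        apply: acl_sub => x [Kx|/=]; first by apply: sub_acl; exists x; apply: RN; exact: sub_clo.
        rewrite !inE => /orP[]/eqP->; apply: sub_acl.
          by exists (g y); apply: RM; apply: mem_clo; rewrite /= inE.
        by exists z; apply: RN; apply: mem_clo; rewrite /= inE.
      apply: acl_sub => x [_ [I [u [m [Nu Mm [-> _]]]]]].
      apply: (subfield_sum (HU y)) => i; apply: (subfieldM (HU y)).
        by apply: (cloS y).2; exact: Mm.
      by apply: (cloS y).1; exact: Nu.
    + apply/seteqP; split; last first.
        apply: acl_sub => x [Kx|/=]; first by apply: sub_acl; exists x; apply: RN; exact: sub_clo.
        rewrite !inE => /orP[]/eqP->; apply: sub_acl.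
          by exists y; apply: RM; apply: mem_clo; rewrite /= inE.
        by exists z; apply: RN; apply: mem_clo; rewrite /= inE.
      apply: acl_sub => x [_ [I [u [m [Nu Mm [_ ->]]]]]].
      apply: (subfield_sum (HU (g y))) => i; apply: (subfieldM (HU (g y))).
        apply: (cloS (g y)).2; have := clo_image K [:: y] g; rewrite (image_fixator gK) /= => <-.
        by exists (m i).
      by apply: (cloS (g y)).1; exact: Nu.
  - by move=> x kx; apply: RN; apply: sub_clo; exact: kK.
exists h; first by move=> x /RN/Hh.
by move=> x /RM/Hh.
Qed.

Variables (H : set (fieldAut k)) (HH : subgroup H).

(** * The partition of F outside K into minimal fields *)

Section MinimalDimension.
Variables (K : set F) (d : nat).
Hypotheses (EK : acl K = K) (kK : k `<=` K).

Definition minimal_field X := fdim K X d /\ fixator k X `<=` H.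

Hypothesis dmin : forall B e, fdim K B e -> fixator k B `<=` H -> (d <= e)%N.
(** To be supplied by the induction on dimension in [smallest_field], applied over the closure of
    K(z). *)
Hypothesis uniq_minimal : forall X Y z, minimal_field X -> minimal_field Y ->
  X z -> Y z -> ~ K z -> X = Y.
Variables (A B : set F) (e : nat).
Hypotheses (HA : minimal_field A) (HB : fdim K B e) (HBH : fixator k B `<=` H).
Variable y : F.
Hypotheses (Ay : A y) (nBy : ~ B y).

Let Hmul g h : H g -> H h -> H (g * h)%g.
Proof. by have [_ hM _] := (subgroupP H).1 HH; exact: hM. Qed.

Let minimal_acl X : minimal_field X -> acl X = X.
Proof. by move=> [/fdim_acl]. Qed.

Let minimal_kX X : minimal_field X -> k `<=` X.
Proof. by move=> [/fdim_sub KX _]; exact: subset_trans KX. Qed.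

Let minimal_image X g : minimal_field X -> H g -> fixator k K g -> minimal_field (g @` X).
Proof. by move=> [XK XH] Hg gK; split; [exact: fdim_image|exact: fixator_image]. Qed.

Let nKy : ~ K y.
Proof. by move=> Ky; apply: nBy; exact: (fdim_sub HB). Qed.

Let BT : B <> setT.
Proof. by move=> BE; apply: nBy; rewrite BE. Qed.

Let kB : k `<=` B.
Proof. by apply: subset_trans kK _; exact: fdim_sub HB. Qed.

(** If [A] were F, then [B], of dimension at least [d], would be all of [A]. *)
Let AT : A <> setT.
Proof.
move=> AE; apply: nBy; suff -> : B = A by [].
by apply: (fdim_eq HB HA.1); [rewrite AE|exact: dmin HB HBH].
Qed.

Let minimal_T X : minimal_field X -> X <> setT.
Proof.
move=> HX XE; apply: AT; rewrite -XE.
by apply: (fdim_eq HA.1 HX.1) => //; rewrite XE.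
Qed.

(** An automorphism fixing [B] takes [y] to a point outside [A]. *)
Let other : exists2 M, minimal_field M & M <> A.
Proof.
have [z [nAz nBz]] := proper_union (acl_subfield (minimal_acl HA))
  (acl_subfield (fdim_acl HB)) AT BT.
have [g gB gy] := homogeneous_point (fdim_acl HB) kB nBy nBz.
exists (g @` A); last by move=> E; apply: nAz; rewrite -E; exists y.
apply: minimal_image => //; first exact: HBH.
by apply: fixatorS gB; exact: fdim_sub HB.
Qed.

(** A point of a second minimal field outside [A] can be moved to any other point outside [A] by an
    automorphism fixing [A]. *)
Let cover z : exists2 X, minimal_field X & X z.
Proof.
have [Az|nAz] := pselect (A z); first by exists A.
have [M HM MA] := other.
have [m [Mm nAm]] : exists m, M m /\ ~ A m.
  apply: contrapT => /forallNP Hm; apply: MA; apply: (fdim_eq HM.1 HA.1) => // m Mm.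
  by apply: contrapT => nAm; exact: (Hm m).
have [g gA gm] := homogeneous_point (minimal_acl HA) (minimal_kX HA) nAm nAz.
exists (g @` M); last by exists m.
apply: minimal_image => //; first exact: HA.2.
by apply: fixatorS gA; exact: fdim_sub HA.1.
Qed.

Let disjoint X Y x : minimal_field X -> minimal_field Y -> X <> Y -> X x -> ~ K x -> ~ Y x.
Proof. by move=> HX HY XY Xx nKx Yx; apply: XY; exact: uniq_minimal Yx nKx. Qed.

(** As [g] fixes [Y] it lies in [H] and permutes the cells of the partition; a cell is preserved
    once one of its points stays in it. *)
Let minimal_fixator X Y x g : minimal_field X -> minimal_field Y ->
  fixator k Y g -> X x -> ~ K x -> X (g x) -> g @` X = X.
Proof.
move=> HX HY gY Xx nKx Xgx; apply: (uniq_minimal (z := g x)) => //.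
- apply: minimal_image => //; first exact: HY.2.
  by apply: fixatorS gY; exact: fdim_sub HY.1.
- move=> Kgx; apply: nKx; have gK : fixator k K g.
    by apply: fixatorS gY; exact: fdim_sub HY.1.
  have [_ _ KV] := (subgroupP _).1 (subgroup_fixator k K).
  by have := KV _ gK _ Kgx; rewrite fieldAutK => ->.
Qed.

(** A [w] in [X] outside the closure of Y(x) could be moved out of [X] by an automorphism fixing [Y]
    and [x], yet such an automorphism preserves [X]. *)
Let minimal_sub X Y x : minimal_field X -> minimal_field Y -> X <> Y -> X x -> ~ K x ->
  X `<=` clo Y [:: x].
Proof.
move=> HX HY XY Xx nKx w Xw; apply: contrapT => nw.
have CT : clo Y [:: x] <> setT by move=> CE; apply: nw; rewrite CE.
have [w' [nw' nXw']] := proper_union (subfield_acl _)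
  (acl_subfield (minimal_acl HX)) CT (minimal_T HX).
have kC : k `<=` clo Y [:: x].
  by apply: subset_trans (minimal_kX HY) _; exact: sub_clo.
have [g gC gw] := homogeneous_point (acl_clo _ _) kC nw nw'.
have gx : g x = x by apply: gC; apply: mem_clo; rewrite /= inE.
have gX : g @` X = X.
  by apply: (minimal_fixator HX HY _ Xx nKx); [apply: fixatorS gC; exact: sub_clo|rewrite gx].
by apply: nXw'; rewrite -gw -gX; exists w.
Qed.

(** For [fixed_lin_disjoint], a point [m] of [X] outside [K] is moved to [m + 1] by an automorphism
    fixing [Y]; it preserves [X], where both points lie. *)
Let minimal_lin_disjoint X Y : minimal_field X -> minimal_field Y -> X <> Y ->
  lin_disjoint K Y X.
Proof.
move=> HX HY XY; have XS := acl_subfield (minimal_acl HX).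
apply: (@fixed_lin_disjoint _ k) => // m Xm nKm.
have X1 : X (m + 1) by apply: (subfieldD XS) => //; exact: subfield1.
have nK1 : ~ K (m + 1).
  have KS := acl_subfield EK.
  move=> K1; apply: nKm; rewrite -[m](addrK 1); apply: (subfieldB KS) => //; exact: subfield1.
have [g gY gm] := homogeneous_point (minimal_acl HY) (minimal_kX HY)
  (disjoint HX HY XY Xm nKm) (disjoint HX HY XY X1 nK1).
exists g; split=> // [z Xz|].
  have gX : g @` X = X by apply: (minimal_fixator HX HY gY Xm nKm); rewrite gm.
  by rewrite -gX; exists z.
move=> gmE; move/eqP: gm; rewrite gmE -subr_eq0 opprD addNKr oppr_eq0 oner_eq0 //.
Qed.

Let minimal_generated X x : minimal_field X -> X x -> ~ K x -> X = clo K [:: x].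
Proof.
move=> HX Xx nKx; apply/seteqP; split; last first.
  apply: clo_sub; [exact: minimal_acl|exact: fdim_sub HX.1|].
  by move=> z /=; rewrite inE => /eqP->.
have [Y HY XY] : exists2 Y, minimal_field Y & X <> Y.
  have [XA|] := pselect (X = A); last by exists A.
  by have [M HM MA] := other; exists M => // XM; apply: MA; rewrite -XM.
move=> w Xw; have := minimal_sub HX HY XY Xx nKx Xw.
rewrite clo_cons clo_nil (minimal_acl HY).
move=> /(acl_adjoin1 (acl_subfield (minimal_acl HY)))[p [n [Yp [i0 pi0] prel]]].
have XS := acl_subfield (minimal_acl HX).
pose D := \max_(i < n) size (p i).
have pD (i : 'I_n) : (size (p i) <= D)%N by rewrite /D (bigmax_sup i).
have [j0 pj0] : exists j0 : 'I_D, (p i0)`_j0 != 0.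
  have p0 : p i0 != 0 by apply: contraNneq pi0 => ->; rewrite horner0.
  have lt : ((size (p i0)).-1 < D)%N.
    by apply: leq_trans (pD i0); rewrite prednK // size_poly_gt0.
  by exists (Ordinal lt); rewrite lead_coef_eq0.
(* The relation of [w] over Y(x) is linear in the monomials in [x] and [w], which lie in [X], with
   coefficients in [Y]; disjointness replaces these by coefficients in [K]. *)
have := minimal_lin_disjoint HY HX (fun E => XY (esym E)).
move=> /(_ _ [set: 'I_n * 'I_D]%SET (fun ij => x ^+ ij.2 * w ^+ ij.1)
             (fun ij => (p ij.1)`_ij.2)).
case.
- by move=> i; apply: (subfieldM XS); exact: (subfieldX XS).
- by move=> i; exact: Yp.
- rewrite -[RHS]prel (eq_bigl xpredT); last by move=> i; rewrite inE.
  rewrite -(pair_bigA _ (fun (i : 'I_n) (j : 'I_D) => (p i)`_j * (x ^+ j * w ^+ i))) /=.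
  apply: eq_bigr => i _; rewrite (horner_coef_wide _ (pD i)) mulr_suml; apply: eq_bigr => j _.
  by rewrite mulrA.
- by exists (i0, j0); rewrite ?inE.
move=> c [Kc [[i1 j1] _ c1] crel].
have {}Kc ij : K (c ij) by apply: Kc; rewrite inE.
rewrite clo_cons clo_nil EK.
pose G := smallest (@subfield F) (x |` K).
have HG : subfield G := subfield_smallest _.
have GK z : K z -> G z by move=> Kz; apply: (@sub_gen_smallest _ (@subfield F)); right.
have Gx : G x by apply: (@sub_gen_smallest _ (@subfield F)); left.
(* The coefficients are extended by zero to all naturals, as [\poly] requires. *)
pose c' (i j : nat) :=
  if insub i is Some i' then if insub j is Some j' then c (i', j') else 0 else 0.
have c'E (i : 'I_n) (j : 'I_D) : c' i j = c (i, j) by rewrite /c' !valK.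
have Kc' i j : K (c' i j).
  have K0 := subfield0 (acl_subfield EK).
  by rewrite /c'; case: insub => // i'; case: insub.
pose q (i : nat) : {poly F} := \poly_(j < D) c' i j.
exists (\poly_(i < n) (q i).[x]); split.
- move=> i; rewrite coef_poly; case: ifP => _; last exact: (subfield0 HG).
  rewrite horner_poly; apply: (subfield_sum HG) => j.
  by apply: (subfieldM HG); [exact: GK|exact: (subfieldX HG)].
(* A zero coefficient at [i1] would make [x] algebraic over [K]. *)
- apply/negP => /eqP/polyP/(_ i1); rewrite coef_poly ltn_ord coef0 => q0.
  apply: nKx; rewrite -EK; exists (q i1); split; last exact/rootP.
    move=> j; rewrite coef_poly; case: ifP => _; last exact: (subfield0 (subfield_smallest K)).
    exact: (@sub_gen_smallest _ (@subfield F)).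
  apply/negP => /eqP/polyP/(_ j1); rewrite coef_poly ltn_ord coef0 c'E => /eqP.
  exact/negP.
- apply/rootP; rewrite -[RHS]crel horner_poly [RHS](eq_bigl xpredT); last by move=> i; rewrite inE.
  rewrite [RHS](eq_bigr (fun ij => c (ij.1, ij.2) * (x ^+ ij.2 * w ^+ ij.1))); last by case.
  rewrite -(pair_bigA _ (fun (i : 'I_n) (j : 'I_D) => c (i, j) * (x ^+ j * w ^+ i))) /=.
  apply: eq_bigr => i _; rewrite horner_poly mulr_suml; apply: eq_bigr => j _.
  by rewrite c'E mulrA.
Qed.

Lemma fixator_base_sub : fixator k K `<=` H.
Proof.
move=> g gK; have AE := minimal_generated HA Ay nKy.
have ngy : ~ K (g y).
  move=> Kgy; apply: nKy; rewrite -(fieldAutK g y).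
  by have [_ _ KV] := (subgroupP _).1 (subgroup_fixator k K); rewrite (KV _ gK).
have gAE : g @` A = clo K [:: g y] by rewrite AE clo_image (image_fixator gK).
(* Since [g] is not known to lie in [H], the image of [A] is identified instead with the cell
   through [g y]: both are the closure of K(g y). *)
have HgA : minimal_field (g @` A).
  have [Z HZ Zgy] := cover (g y).
  by rewrite gAE -(minimal_generated HZ Zgy).
have [z [nz nzg]] := proper_union (acl_subfield (minimal_acl HA))
  (acl_subfield (minimal_acl HgA)) AT (minimal_T HgA).
have nKz : ~ K z by move/(fdim_sub HA.1).
have [X HX Xz] := cover z; have XE := minimal_generated HX Xz nKz.
have XA : A <> X by move=> E; apply: nz; rewrite E.
have XgA : g @` A <> X by move=> E; apply: nzg; rewrite E.
have LD := minimal_lin_disjoint HA HX XA.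
have LDg := minimal_lin_disjoint HgA HX XgA.
have [h hX hg] : exists2 h : fieldAut k, fixator k X h & forall x, A x -> h x = g x.
  rewrite XE AE; apply: glue => //; rewrite -?AE -?XE //.
  by rewrite -gAE.
have -> : g = (h * (h^-1 * g))%g by rewrite mulgA mulgV mul1g.
apply: Hmul; first exact: HX.2.
by apply: HA.2 => x Ax; rewrite fieldAutMP -hg // fieldAutK.
Qed.

End MinimalDimension.

(** The base [K] varies in the induction on [d]. Once [d] is minimal, a [B] not containing [A] would
    put the fixator of [K] into [H], so [d] would be 0 and [A] would be [K]. *)
Lemma smallest_field d K A : acl K = K -> k `<=` K -> fdim K A d -> fixator k A `<=` H ->
  exists L e, [/\ fdim K L e, fixator k L `<=` H &
    forall B e', fdim K B e' -> fixator k B `<=` H -> L `<=` B].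
Proof.
elim/ltn_ind: d K A => d IH K A EK kK KA AH.
have [[A' [d' [KA' A'H lt]]]|nmin] :=
  pselect (exists A' d', [/\ fdim K A' d', fixator k A' `<=` H & (d' < d)%N]).
  exact: IH lt K A' EK kK KA' A'H.
have dmin B e : fdim K B e -> fixator k B `<=` H -> (d <= e)%N.
  by move=> KB BH; rewrite leqNgt; apply/negP => lt; apply: nmin; exists B, e.
exists A, d; split=> // B e KB BH y Ay; apply: contrapT => nBy.
have nKy : ~ K y by move/(fdim_sub KB).
suff : (d <= 0)%N.
  rewrite leqn0 => /eqP d0; apply: nKy; rewrite d0 in KA.
  by have [s [_ /size0nil -> ]] := KA; rewrite clo_nil EK => <-.
apply: (dmin _ _ (fdim0 EK)); apply: (@fixator_base_sub K d EK kK dmin _ A B e _ KB BH y) => //.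
move=> X Y z [KX XH] [KY YH] Xz Yz nKz; have nz : ~ acl K z by rewrite EK.
have [d' dE X'] := fdim_adjoin KX Xz nz; have [d'' dE' Y'] := fdim_adjoin KY Yz nz.
have dd : d'' = d' by move: dE'; rewrite dE => -[].
rewrite {}dd {dE'} in Y'.
have ltd : (d' < d)%N by rewrite dE.
have kKz : k `<=` clo K [:: z] by apply: subset_trans kK _; exact: sub_clo.
have [L [f [KL LH Lmin]]] := IH d' ltd (clo K [:: z]) X (acl_clo _ _) kKz X' XH.
(* [L] has dimension [f] over K(z), hence [f.+1] over [K], which is at least [d]; so [L] fills both
   [X] and [Y]. *)
have df : (d' <= f)%N.
  by have := dmin _ _ (fdim_extend nz KL) LH; rewrite dE ltnS.
rewrite -(fdim_eq KL X' (Lmin _ _ X' XH) df).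
by rewrite -(fdim_eq KL Y' (Lmin _ _ Y' YH) df).
Qed.

End SmallestField.

(** * Comparison of independent lists with transcendence bases *)

Section AlgebraicIndependence.
Local Open Scope card_scope.
Variable F : closedFieldType.
Implicit Types (K L B S : set F) (s t : seq F).

(** If [p] vanished everywhere, [p + 1] would have no root and so be constant. *)
Lemma horner_neq0 (p : {poly F}) : p != 0 -> exists c, p.[c] != 0.
Proof.
move=> p0; apply/not_existsP => H; have pz c : p.[c] = 0.
  by apply/eqP; apply: contrapT => /negP /H.
have [r1|/closed_rootP[c /rootP]] := eqVneq (size (p + 1)) 1%N; last first.
  by rewrite !hornerE pz add0r => /eqP; rewrite oner_eq0.
have /size_poly1P[c _ pE] : size (p + 1) == 1%N by exact/eqP.
have {}pE : p = (c - 1)%:P by rewrite polyCB -pE addrK.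
by move: p0; rewrite pE polyC_eq0 -[c - 1](hornerC _ 0) -pE pz eqxx.
Qed.

Section Evaluation.
Variables (K : set F) (HK : subfield K) (n : nat).
Let SK := subfield_pred HK.

Lemma subring_meval (t : 'I_n -> F) :
  subring_set [set p.@[t] | p in [set p : {mpoly F[n]} | p \is a mpolyOver n SK]].
Proof.
split.
- by exists 1; rewrite ?meval1 //=; exact: rpred1.
- by move=> _ _ [p Kp <-] [q Kq <-]; exists (p - q); rewrite ?mevalB //=; exact: rpredB.
- by move=> _ _ [p Kp <-] [q Kq <-]; exists (p * q); rewrite ?mevalM //=; exact: rpredM.
Qed.

Lemma mwiden_supp (p : {mpoly F[n]}) :
  mwiden p = \sum_(m <- msupp p) p@_m *: 'X_[mnmwiden m].
Proof.
rewrite [in LHS](mpolyE p) (raddf_sum (@mwiden n F)).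
by apply: eq_bigr => m _ /=; rewrite mwidenZ mwidenX.
Qed.

Lemma mpolyOver_mwiden (p : {mpoly F[n]}) : p \is a mpolyOver n SK ->
  mwiden p \is a mpolyOver n.+1 SK.
Proof.
move=> /mpolyOverP Kp; rewrite mwiden_supp; apply: rpred_sum => m _.
by apply: mpolyOverZ; rewrite ?Kp // mpolyOverX.
Qed.

Lemma meval_mwiden (p : {mpoly F[n]}) (y : 'I_n.+1 -> F) :
  (mwiden p).@[y] = p.@[fun i => y (widen_ord (leqnSn n) i)].
Proof.
rewrite mwiden_supp [RHS]mevalE raddf_sum; apply: eq_bigr => m _ /=.
rewrite mevalZ mevalX big_ord_recr /= mnmwiden_ordmax expr0 mulr1.
by congr (_ * _); apply: eq_bigr => i _; rewrite mnmwiden_widen.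
Qed.

End Evaluation.

(** A polynomial over K[s] vanishing at [x] lifts to a polynomial [Q] in one more variable vanishing
    at [s] and [x]. Independence gives [Q = 0], so the original polynomial vanishes everywhere. *)
Lemma alg_independent_indep K B s : subfield K -> alg_independent K B ->
  uniq s -> [set` s] `<=` B -> indep K s.
Proof.
move=> HK HB; elim: s => //= x s IH /andP[xs us] sB; split; last first.
  by apply: IH => // y ys; apply: sB; rewrite /= inE ys orbT.
pose n := size s; pose t (i : 'I_n) := nth 0 s i.
have := subring_meval HK t; set A := (A in subring_set A) => HA Hx.
have /(acl_subring HA)[P [AP P0 /rootP Px]] : acl A x.
  apply: aclS Hx => z [Kz|/= zs].
    exists z%:MP; last by rewrite mevalC.
    by rewrite /= mpolyOverC; exact/mem_set.
  have lt : (index z s < n)%N by rewrite index_mem.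
  exists 'X_(Ordinal lt); last by rewrite mevalXU /t /= nth_index.
  exact: mpolyOverX.
have /choice[p Hp] : forall i, exists p : {mpoly F[n]},
    p \is a mpolyOver n (subfield_pred HK) /\ p.@[t] = P`_i.
  by move=> i; have [p ? ?] := AP i; exists p.
(* The default value of [nth] provides the last coordinate: index [n] lies just past the end of
   [s]. *)
pose y c (i : 'I_n.+1) := nth c s i.
have yt c : (fun i => y c (widen_ord (leqnSn n) i)) =1 t.
  by move=> i; rewrite /y /t /=; apply: set_nth_default.
have ymax c : y c ord_max = c by rewrite /y nth_default.
pose Q := \sum_(j < size P) mwiden (p j) * 'X_ord_max ^+ j.
have QE c : Q.@[y c] = P.[c].
  rewrite raddf_sum horner_coef; apply: eq_bigr => j _ /=.
  rewrite mevalM meval_mwiden (meval_eq _ (yt c)) rmorphXn /= mevalXU ymax.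
  by have [_ ->] := Hp j.
have QK : Q \is a mpolyOver n.+1 (subfield_pred HK).
  apply: rpred_sum => j _; apply: rpredM; last exact/rpredX/mpolyOverX.
  by apply: mpolyOver_mwiden; have [] := Hp j.
have yx : y x =1 nth 0 (rcons s x).
  move=> i; rewrite /y nth_rcons; case: ltnP => [lt|]; first exact: set_nth_default.
  by move=> le; rewrite nth_default //; case: eqP => // /eqP; rewrite eqn_leq le -ltnS ltn_ord.
have Q0 : Q = 0.
  apply: (HB n.+1 (y x)).
  - move=> i j; rewrite !yx => /eqP; rewrite nth_uniq ?size_rcons ?ltn_ord ?rcons_uniq ?xs //.
    by move=> /eqP/val_inj.
  - move=> _ [i _ <-]; apply: sB; rewrite /= yx.
    have : nth 0 (rcons s x) i \in rcons s x by rewrite mem_nth // size_rcons.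
    by rewrite mem_rcons.
  - by move=> m; apply/set_mem; move/mpolyOverP: QK; apply.
  - by rewrite QE.
have [c] := horner_neq0 P0; rewrite -QE Q0 meval0 eqxx //.
Qed.

Lemma indep_notin K s x : indep K s -> x \in s -> ~ clo K (rem x s) x.
Proof.
move=> Is xs H; have : (size s <= size (rem x s))%N.
  apply: (steinitz Is) => y ys; have [->//|yx] := eqVneq y x.
  by apply: mem_clo; move: ys; rewrite /= (perm_mem (perm_to_rem xs)) inE (negPf yx).
by rewrite size_rem // leqNgt prednK ?leqnn //; case: s xs {Is H}.
Qed.

Lemma indep_uniq K s : indep K s -> uniq s.
Proof.
elim: s => //= x s IH [nx /IH ->]; rewrite andbT; apply/negP => xs.
by apply: nx; apply: sub_acl; right.
Qed.

Lemma indep_alg_independent K s : indep K s -> alg_independent K [set` s].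
Proof.
move=> Is n x xinj xs p Kp px; apply/eqP; apply: contrapT => /negP p0.
have [i Hi] := algebraic_dependence Kp p0 px.
have xis : x i \in s by apply: xs; exists i.
apply: (indep_notin Is xis); apply: aclS Hi; apply: setUS => _ [j ji <-] /=.
rewrite mem_rem_uniq ?(indep_uniq Is) // inE; apply/andP; split; last by apply: xs; exists j.
by apply: contra_neq ji => /xinj.
Qed.

Lemma card_set_seq s : uniq s -> [set` s] #= `I_(size s).
Proof.
move=> us; apply/card_set_bijP; exists (index^~ s); split.
- by move=> x /= xs; rewrite index_mem.
- by move=> x y /set_mem /= xs /set_mem /= ys E; rewrite -(nth_index x xs) E nth_index.
- by move=> i /= lt; exists (nth 0 s i); rewrite /= ?mem_nth // index_uniq.
Qed.

Lemma seq_of_card B m : B #= `I_m -> exists2 s, size s = m & B = [set` s].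
Proof.
move=> Bm; have /finite_seqP[s Bs] : finite_set B by apply/finite_setP; exists m.
exists (undup s); last by rewrite Bs; apply/seteqP; split=> x /=; rewrite mem_undup.
apply/card_eq_II; apply: card_eq_trans Bm.
have -> : B = [set` undup s].
  by rewrite Bs; apply/seteqP; split=> x /=; rewrite mem_undup.
by rewrite card_eq_sym; apply: card_set_seq; exact: undup_uniq.
Qed.

Lemma fdim_trdeg K A d : fdim K A d -> trdeg K A (Some d).
Proof.
move=> [s [Is sd AE]]; exists [set` s]; last first.
  by rewrite -sd; apply: card_set_seq; exact: indep_uniq Is.
split; first by rewrite AE; exact: mem_clo.
  exact: indep_alg_independent.
by rewrite AE.
Qed.

Lemma trdeg_ge K A L d m : fdim K A d -> trdeg K L (Some m) -> A `<=` L -> (d <= m)%N.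
Proof.
move=> [s [Is sd AE]] [B [_ _ LB] /seq_of_card[t <- BE]] AL; rewrite -sd.
apply: (steinitz Is); apply: subset_trans (_ : L `<=` _); last by rewrite /clo -BE.
by apply: subset_trans AL; rewrite AE; exact: mem_clo.
Qed.

Lemma trdeg_infinite K d : subfield K -> trdeg K setT None -> ~ fdim K setT d.
Proof.
move=> HK [B [_ HB _]] /card_set_bijP[f [_ _ fs]] [s [_ sd sE]].
have /choice[g gP] : forall i, exists x, B x /\ f x = i.
  by move=> i; have [x Bx <-] := fs i I; exists x.
have /steinitz : indep K (map g (iota 0 d.+1)).
  apply: (alg_independent_indep HK HB).
    rewrite map_inj_uniq ?iota_uniq // => i j E.
    by rewrite -(gP i).2 E (gP j).2.
  by move=> x /mapP[i _ ->]; exact: (gP i).1.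
move=> /(_ s); rewrite -sE => /(_ (@subsetT _ _)).
by rewrite size_map size_iota sd ltnn.
Qed.

(** Only generation up to algebraic closure is kept, so [b] may take a junk value off the basis, and
    finite and countable bases are treated alike. *)
Lemma trdeg_enum K n : trdeg K setT n -> exists b : nat -> F, acl (K `|` range b) = setT.
Proof.
move=> [B [_ _ BT] Bn]; have : countable B.
  case: n Bn => [m|] Bn; first by apply: finite_set_countable; apply/finite_setP; exists m.
  by move: Bn; rewrite card_eq_le => /andP[].
move=> /countable_injP[f finj].
have /choice[b Hb] : forall i, exists x, forall y, B y -> f y = i -> y = x.
  move=> i; have [[x [Bx fx]]|nx] := pselect (exists x, B x /\ f x = i).
    by exists x => y By fy; apply: finj; [exact/mem_set|exact/mem_set|rewrite fx].
  by exists 0 => y By fy; case: nx; exists y.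
exists b; apply/seteqP; split=> // x _; apply: aclS (BT x I); apply: setUS => y By.
by exists (f y) => //; apply/esym; exact: Hb.
Qed.

End AlgebraicIndependence.

(** * The map alpha, its characterizations and the maximal subgroups *)

Section Alpha.
Variables (F : closedFieldType) (k : acSubfield F) (b : nat -> F).
Hypothesis kb : acl (k `|` range b) = setT.
Implicit Types (g h : fieldAut k) (L : APi k) (H : openSubgroup k) (A : set F).

Let acl_k : acl k = k.
Proof. exact/acl_id/ac_setP. Qed.

Lemma APi_acl_id L : acl L = L.
Proof. exact/acl_id/ac_setP. Qed.

Lemma APi_fdim L : exists d, fdim k L d.
Proof.
have [S /finite_seqP[s ->] ->] := APi_acl L.
exact: fdim_clo.
Qed.

Lemma fdim_APi A d : fdim k A d -> exists L, L = A :> set F.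
Proof.
move=> Ad; have ac : alg_closed_subfield A by rewrite -(fdim_acl Ad); exact: alg_closed_acl.
have td : exists m, trdeg k A (Some m) by exists d; exact: fdim_trdeg.
by exists (@MkAPi F k (AcSubfield ac) (fdim_sub Ad) td).
Qed.

Lemma fixator_k g : fixator k k g.
Proof. by move=> x; exact: fieldAut_fix. Qed.

(** If [g] normalizes the fixator of [A], each [g x] with [x] in [A] is fixed by that fixator and so
    lies in [A]. *)
Lemma normalizer_fixator A : acl A = A -> k `<=` A ->
  normalizer (fixator k A) = set_stabilizer k A.
Proof.
move=> EA kA.
have conjE h g x : (h ^ g)%g x = (g^-1)%g (h (g x)) by rewrite conjgE.
have sub g : normalizer (fixator k A) g -> g @` A `<=` A.
  move=> ng _ [x Ax <-]; apply: (fixed_field kb EA kA) => h hA.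
  have : fixator k A (h ^ g)%g by rewrite -ng; exists h.
  move=> /(_ x Ax); rewrite conjE => /(congr1 g); by rewrite fieldAutKV.
have [_ _ NV] := (subgroupP _).1 (subgroup_normalizer (fixator k A)).
apply/seteqP; split=> g ng.
  apply/seteqP; split; first exact: sub.
  rewrite -[X in X `<=` _](image_fieldAutKV g); apply: image_subset.
  exact/sub/NV.
have sub' (f : fieldAut k) : f @` A = A -> [set (h ^ f)%g | h in fixator k A] `<=` fixator k A.
  move=> fA _ [h hA <-] x Ax; rewrite conjE hA ?fieldAutK //.
  by rewrite -fA; exists x.
apply/seteqP; split; first exact: sub'.
move=> h hA; exists (h ^ g^-1)%g; last by rewrite conjgKV.
apply: (sub' g^-1%g); last by exists h.
by rewrite -[in LHS]ng image_fieldAutK.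
Qed.

Lemma subgroup_stabilizer A : acl A = A -> k `<=` A -> subgroup (set_stabilizer k A).
Proof. by move=> EA kA; rewrite -normalizer_fixator //; exact: subgroup_normalizer. Qed.

Lemma fixator_stabilizer A : fixator k A `<=` set_stabilizer k A.
Proof. by move=> g /image_fixator. Qed.

(** A point of [L2] outside [L1] could be moved out of [L2] by an automorphism fixing [L1]. *)
Lemma fixator_sub_stabilizer L1 L2 : L1 `<=` L2 -> (L2 : set F) <> setT ->
  fixator k L1 `<=` set_stabilizer k L2 -> L1 = L2 :> set F.
Proof.
move=> s /eqP/setTPn[z nz] fs; apply/seteqP; split=> // y L2y; apply: contrapT => n1.
have nz1 : ~ (L1 : set F) z by move=> /s.
have [g gL gy] := homogeneous_point kb (APi_acl_id L1) (@APi_sub _ _ L1) n1 nz1.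
by apply: nz; rewrite -gy -(fs g gL); exists y.
Qed.

Lemma smallest_APi (N : set (fieldAut k)) L0 : subgroup N -> fixator k L0 `<=` N ->
  exists L, fixator k L `<=` N /\ forall L', fixator k L' `<=` N -> L `<=` L'.
Proof.
move=> HN L0N; have [d d0] := APi_fdim L0.
have [A [e [Ae AN Amin]]] := smallest_field kb HN acl_k (@subset_refl _ k) d0 L0N.
have [L LA] := fdim_APi Ae; exists L; rewrite LA; split=> // L' L'N.
by have [d' d'L] := APi_fdim L'; exact: Amin d'L L'N.
Qed.

Lemma alpha_ex H : exists L, fixator k L `<=` H /\
  forall L', fixator k L' `<=` H -> L `<=` L'.
Proof.
have /subgroupP[H1 _ _] := openSubgroupP H.
have := openSubgroup_open H; rewrite openE => /(_ _ H1)[S /finite_seqP[s ->] SH].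
have [d] := fdim_clo k s => /fdim_APi[L LE].
apply: (@smallest_APi _ L); first exact: openSubgroupP.
move=> g gL; have := SH g; rewrite mul1g; apply => x xs.
by apply: gL; rewrite LE; exact: mem_clo.
Qed.

Definition alpha H : APi k := sval (cid (alpha_ex H)).

Lemma fixator_alpha H : fixator k (alpha H) `<=` H.
Proof. by rewrite /alpha; case: cid => L []. Qed.

Lemma alpha_min H L : fixator k L `<=` H -> alpha H `<=` L.
Proof. by rewrite /alpha; case: cid => L' [_ +] /= LH; exact. Qed.

Lemma alpha_anti H1 H2 : H1 `<=` H2 -> alpha H2 `<=` alpha H1.
Proof. by move=> s; apply: alpha_min; apply: subset_trans s; exact: fixator_alpha. Qed.

(** Formal from a Galois connection: G_{F|L} lies in H exactly when alpha(H) lies in L. *)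
Lemma alpha_nmod_morphism : nmod_morphism alpha.
Proof.
split=> [|H1 H2]; apply: APi_eq; apply/seteqP; split.
- exact: alpha_min.
- exact: APi_sub.
- apply: alpha_min => g gL.
  have sub (L1 L2 : APi k) :
      (L1 : set F) `<=` (L1 + L2 : APi k) /\ (L2 : set F) `<=` (L1 + L2 : APi k).
    by split; apply: subset_trans (@sub_acl _ _) => x; [left|right].
  split; apply: fixator_alpha => x Lx; apply: gL.
    exact: (sub (alpha H1) (alpha H2)).1.
  exact: (sub (alpha H1) (alpha H2)).2.
- rewrite -[X in _ `<=` X](APi_acl_id (alpha (H1 + H2))).
  apply: aclS; rewrite subUset; split; apply: alpha_anti => g; by case.
Qed.

HB.instance Definition _ :=
  GRing.isNmodMorphism.Build (openSubgroup k) (APi k) alpha alpha_nmod_morphism.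

Lemma alpha_surjective L : exists H, alpha H = L.
Proof.
have [S Sfin LE] := APi_acl L.
exists (OpenSubgroup (subgroup_fixator k S) (open_fixator Sfin)).
apply: APi_eq; apply/seteqP; split.
  apply: alpha_min => /=; apply: fixatorS; rewrite LE.
  by apply: subset_trans (@sub_acl _ _) => x; right.
rewrite LE -[X in _ `<=` X]APi_acl_id; apply: aclS; rewrite subUset; split.
  exact: APi_sub.
move=> x Sx; apply: (fixed_field kb (APi_acl_id _) (@APi_sub _ _ _)) => g.
by move=> /fixator_alpha; apply.
Qed.

Lemma alpha_eq H L d : fixator k L `<=` H ->
  fdim k L d -> (forall e, fdim k (alpha H) e -> (d <= e)%N) -> L = alpha H.
Proof.
move=> LH Ld le; apply: APi_eq; have [e ae] := APi_fdim (alpha H).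
by apply/esym; apply: (fdim_eq ae Ld); [exact: alpha_min|exact: le].
Qed.

(** Not restricted to [g] in [H], so that it applies to the normalizer of [H] as well. *)
Lemma alpha_image H g : fixator k (g @` alpha H) `<=` H -> g @` alpha H = alpha H.
Proof.
move=> gH; have [d ad] := APi_fdim (alpha H).
have gd := fdim_image ad (@fixator_k g); have [L LE] := fdim_APi gd.
rewrite -LE; congr (_ : set F); rewrite -LE in gd gH.
by congr ac_set; congr APi_field; apply: (alpha_eq gH gd) => e /(fdim_inj ad) ->.
Qed.

Lemma sub_stabilizer_alpha H : H `<=` set_stabilizer k (alpha H).
Proof.
move=> g Hg; apply: alpha_image; apply: fixator_image (@fixator_alpha H) => //.
exact: openSubgroupP.
Qed.

Lemma condition_a_alpha H : condition_a H (alpha H).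
Proof.
split; last first.
  move=> [L [LT [_ _ LH _]]] aT; apply: LT; apply/seteqP; split=> //.
  by rewrite -aT; exact: alpha_min.
split; [exact: subgroup_fixator|exact: openSubgroupP|exact: fixator_alpha|].
rewrite normalizer_fixator ?APi_acl_id //; last exact: APi_sub.
exact: sub_stabilizer_alpha.
Qed.

(** If L is not F, then G_{F|alpha(H)} lies in H, hence normalizes G_{F|L} and stabilizes L, so the
    inclusion of alpha(H) in L is an equality. If L is F, the proviso leaves only alpha(H) = F. *)
Lemma condition_a_uniq H L : condition_a H L -> L = alpha H.
Proof.
move=> [[_ _ LH HN] LT]; apply: APi_eq.
have aL := alpha_min LH.
have [LE|nLT] := pselect (L = setT :> set F).
  apply: contrapT => neq; apply: LT => //; exists (alpha H); split.
    by move=> aT; apply: neq; rewrite LE aT.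
  by have [] := condition_a_alpha H.
apply/esym; apply: fixator_sub_stabilizer => //.
rewrite -normalizer_fixator ?APi_acl_id //; last exact: APi_sub.
by apply: subset_trans HN; exact: fixator_alpha.
Qed.

Lemma condition_b_alpha H : condition_b H (alpha H).
Proof.
split; first exact: fixator_alpha.
have [d ad] := APi_fdim (alpha H); exists d; split; first exact: fdim_trdeg.
by move=> L m /alpha_min aL Lm; exact: trdeg_ge ad Lm aL.
Qed.

Lemma condition_b_uniq H L : condition_b H L -> L = alpha H.
Proof.
move=> [LH [m [Lm mmin]]]; have [d Ld] := APi_fdim L.
apply: (alpha_eq LH Ld) => e ae; apply: leq_trans (trdeg_ge Ld Lm _) _ => //.
by apply: mmin (@fixator_alpha H) _; exact: fdim_trdeg.
Qed.

(** Both points are completed to bases of [L] of the same length, and one basis is carried to the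
    other. *)
Lemma stabilizer_transitive L y z : (L : set F) y -> (L : set F) z ->
  ~ (k : set F) y -> ~ (k : set F) z ->
  exists2 g, set_stabilizer k L g & g y = z.
Proof.
have [d Ld] := APi_fdim L; move=> Ly Lz; rewrite -{1 2}acl_k => ny nz.
have [e dE [s [Is se sE]]] := fdim_adjoin Ld Ly ny.
have [e' dE' [t [It te tE]]] := fdim_adjoin Ld Lz nz.
have ee : e = e' by move: dE'; rewrite dE => -[].
have I1 u : ~ acl k u -> indep k [:: u] by split=> //; rewrite -/(clo _ _) clo_nil.
have st : size s = size t by rewrite se te.
have [|g _] := homogeneous_seq kb acl_k (@subset_refl _ k) _
  (indep_cat (I1 y ny) Is) (indep_cat (I1 z nz) It).
  by rewrite !size_cat st.
rewrite map_cat => /eqP; rewrite eqseq_cat ?size_map // => /andP[/eqP gs /eqP [gy]].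
exists g => //; rewrite /set_stabilizer /= [in LHS]sE clo_cat clo_image.
rewrite (image_fixator (@fixator_k g)) map_cat gs /= gy [in RHS]tE.
by rewrite clo_cat.
Qed.

Lemma stabilizer_proper L : (L : set F) <> setT -> (L : set F) <> k ->
  set_stabilizer k L <> setT.
Proof.
move=> LT Lk sT; apply: Lk; apply/esym.
apply: (@fixator_sub_stabilizer (APi0 k)) => //; first exact: APi_sub.
by rewrite sT.
Qed.

(** An overgroup N preserves the smallest A with G_{F|A} in N, and A lies in L. As the stabilizer of
    L is transitive on L outside k, either A is k and N is everything, or A is L. *)
Lemma maximal_stabilizer L : (L : set F) <> setT -> (L : set F) <> k ->
  maximal_subgroup (set_stabilizer k L).
Proof.
move=> LT Lk; split; first by apply: subgroup_stabilizer; [exact: APi_acl_id|exact: APi_sub].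
  exact: stabilizer_proper.
move=> N HN LN; have fN : fixator k L `<=` N.
  by apply: subset_trans LN; exact: fixator_stabilizer.
have [A [AN Amin]] := smallest_APi HN fN.
have NA : N `<=` set_stabilizer k A.
  move=> g Ng; have [d Ad] := APi_fdim A.
  have gd := fdim_image Ad (@fixator_k g); have [A' A'E] := fdim_APi gd.
  have : fixator k A' `<=` N by rewrite A'E; exact: fixator_image.
  move=> /Amin; rewrite A'E => s; rewrite /set_stabilizer /=.
  by rewrite -(fdim_eq Ad gd s).
have [Ak|] := pselect (A `<=` k).
  by right; apply/seteqP; split=> // g _; apply: AN => x /Ak; exact: fixator_k.
move=> /existsNP[y /not_implyP[Ay nky]]; left.
suff AL : A = L :> set F by apply/seteqP; split=> //; rewrite -AL.
have sAL := Amin L fN; apply/seteqP; split=> // z Lz; apply: contrapT => nAz.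
have nkz : ~ (k : set F) z by move=> kz; apply: nAz; exact: APi_sub.
have [g gL gy] := stabilizer_transitive (sAL _ Ay) Lz nky nkz.
by apply: nAz; rewrite -gy -(NA g (LN g gL)); exists y.
Qed.

Section InfiniteTrdeg.
Hypothesis infinite_trdeg : trdeg k [set: F] None.

Lemma APi_proper L : (L : set F) <> setT.
Proof.
move=> LT; have [d] := APi_fdim L; rewrite LT; apply: trdeg_infinite => //.
by have [] := ac_setP k.
Qed.

(** Elements of N, the normalizer of H, send alpha(H) to a field whose fixator still lies in H, so N
    stabilizes alpha(H). It contains the fixator of alpha(N), and alpha(H) is not F because n is
    infinite. *)
Lemma alpha_normalizer H : alpha H = alpha (openSubgroup_normalizer H).
Proof.
set N := openSubgroup_normalizer H; have HN : H `<=` N by exact/sub_normalizer/openSubgroupP.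
apply/esym/APi_eq; apply: fixator_sub_stabilizer.
- exact: alpha_anti.
- exact: APi_proper.
- apply: subset_trans (@fixator_alpha N) _ => g Ng; apply: alpha_image => h hg.
  have : (H : set (fieldAut k)) (h ^ g)%g.
    by apply: (@fixator_alpha H) => x ax; rewrite conjgE !fieldAutMP hg ?fieldAutK //; exists x.
  by rewrite -{1}(_ : [set (h ^ g)%g | h in H] = H) // => -[h' Hh' /conjg_inj <-].
Qed.

Lemma proper_alpha H : (H : set _) <> setT -> (alpha H : set F) <> k.
Proof.
move=> HT ak; apply: HT; apply/seteqP; split=> // g _; apply: fixator_alpha.
by rewrite ak; exact: fixator_k.
Qed.

End InfiniteTrdeg.

End Alpha.

Theorem proposition2p6 (F : closedFieldType) (k : acSubfield F)
    (n : option nat) (F_char0 : [pchar F] =i pred0)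
    (n_gt0 : n <> Some 0%N) (F_trdeg : trdeg k [set: F] n) :
  [/\ exists alpha : {additive openSubgroup k -> APi k},
        [/\ (forall L : APi k, exists H : openSubgroup k, alpha H = L),
            (forall H1 H2 : openSubgroup k,
               H1 `<=` H2 -> alpha H2 `<=` alpha H1),
            (forall beta : openSubgroup k -> APi k,
               (forall H, condition_a H (beta H)) <-> beta = alpha),
            (forall beta : openSubgroup k -> APi k,
               (forall H, condition_b H (beta H)) <-> beta = alpha) &
            n = None ->
              forall H, alpha H = alpha (openSubgroup_normalizer H)],
      (forall L : APi k,
         (L : set F) <> [set: F] -> (L : set F) <> k ->
         normalizer (fixator k L) = set_stabilizer k L /\
         maximal_subgroup (set_stabilizer k L)) &
      n = None ->
        (forall H : openSubgroup k,
           (H : set (fieldAut k)) <> [set: fieldAut k] ->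
           exists2 M : set (fieldAut k), maximal_subgroup M & H `<=` M) /\
        (forall M : set (fieldAut k),
           maximal_subgroup M -> open M ->
           exists2 L : APi k,
             (L : set F) <> k & M = set_stabilizer k L)].
Proof.
have [b kb] := trdeg_enum F_trdeg; split.
- exists (alpha kb : {additive openSubgroup k -> APi k}); split.
  + exact: alpha_surjective.
  + exact: alpha_anti.
  + move=> beta; split=> [cond|-> H]; last exact: condition_a_alpha.
    by apply/funext => H; exact: condition_a_uniq.
  + move=> beta; split=> [cond|-> H]; last exact: condition_b_alpha.
    by apply/funext => H; exact: condition_b_uniq.
  + by move=> nE; rewrite nE in F_trdeg => H; exact: alpha_normalizer.
- move=> L LT Lk; split; last exact: maximal_stabilizer kb L LT Lk.
  by apply: (normalizer_fixator kb); [exact: APi_acl_id|exact: APi_sub].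
- move=> nE; rewrite nE in F_trdeg; split=> [H HT|M Mmax Mopen].
    exists (set_stabilizer k (alpha kb H)); last exact: sub_stabilizer_alpha.
    apply: (maximal_stabilizer kb); first exact: APi_proper F_trdeg _.
    exact: proper_alpha.
  have [HM MT Mm] := Mmax; pose H := OpenSubgroup HM Mopen.
  have ak : (alpha kb H : set F) <> k by exact: proper_alpha.
  exists (alpha kb H) => //.
  have aT : (alpha kb H : set F) <> setT by exact: APi_proper.
  have [sS sT _] := maximal_stabilizer kb aT ak.
  (* [M] lies in the stabilizer of its own alpha, which is proper; maximality of [M] makes them
     equal. *)
  have [//|/sT//] := Mm _ sS (@sub_stabilizer_alpha _ _ _ kb H).
Qed.
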